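(* There is an absolute constant $c>0$ such that for every $T>0$ and all functions $\lambda,\widetilde{\lambda}\colon[0,T]\to\mathbb{R}$ satisfying $|\lambda(t_1)-\lambda(t_2)|\le |t_1-t_2|^{1/2}$ and $|\widetilde\lambda(t_1)-\widetilde\lambda(t_2)|\le |t_1-t_2|^{1/2}$ for all $t_1,t_2\in[0,T]$, the slits $\gamma^{\lambda},\gamma^{\widetilde\lambda}$ generated by $\lambda,\widetilde\lambda$ satisfy $$\sup_{t\in[0,T]}\left|\gamma^{\lambda}(t)-\gamma^{\widetilde\lambda}(t)\right|\le c\,\sup_{t\in[0,T]}\left|\lambda(t)-\widetilde\lambda(t)\right|.$$
   Context: Let $\mathbb{H}=\{z\in\mathbb{C}:\operatorname{Im} z>0\}$. For a continuous $\lambda\colon[0,T]\to\mathbb{R}$ (a driving function), let $g_t(z)$ be the solution of the chordal Loewner equation $\partial_t g_t(z)=\frac{2}{g_t(z)-\lambda(t)}$, $g_0(z)=z$, and let $H_t$ be the set of $z\in\mathbb{H}$ for which the solution is well defined up to time $t$ (i.e. $g_s(z)\ne\lambda(s)$ for $s\in[0,t]$). Then $g_t\colon H_t\to\mathbb{H}$ is conformal. Put $\|\lambda\|_{\mathrm{Lip}(1/2)}=\sup_{t_1\ne t_2\in[0,T]}|\lambda(t_1)-\lambda(t_2)|/|t_1-t_2|^{1/2}$. It is known (Marshall–Rohde, Lind) that if $\|\lambda\|_{\mathrm{Lip}(1/2)}<4$, then $\lambda$ generates a slit $\gamma=\gamma^{\lambda}\colon[0,T]\to\overline{\mathbb{H}}$: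 a simple curve with $\gamma(0)=\lambda(0)\in\mathbb{R}$, $\gamma(t)\in\mathbb{H}$ for $0<t\le T$, and $H_t=\mathbb{H}\setminus\gamma([0,t])$ for all $t$; moreover $\gamma(t)=\lim_{y\downarrow0}g_t^{-1}(\lambda(t)+iy)$. *)

(* Defs.v *)
From Stdlib Require Import Reals.
From Coquelicot Require Import Coquelicot.

Open Scope R_scope.

Definition Icc (a b : R) : R -> Prop := fun x => a <= x <= b.

(* Derivative of a complex-valued function at a point [x] of [D] relative to
   [D]: Coquelicot's [is_derive] with [locally x] replaced by
   [within D (locally x)], so it is one-sided at an endpoint of an interval. *)
Definition is_derive_within (D : R -> Prop) (f : R -> C) (x : R) (l : C) : Prop :=
  filterdiff (K := R_AbsRing) (U := R_NormedModule) (V := C_R_NormedModule)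
    f (within D (locally x)) (fun h => scal h l).

Definition upper_half_plane : C -> Prop := fun z => 0 < Im z.

(* [g s] is g_s(z); the values of [g] outside [0,t] are irrelevant. *)
Record loewner_solution (lambda : R -> R) (t : R) (z : C) (g : R -> C) : Prop := {
  loewner_init : g 0 = z;
  loewner_avoid : forall s, Icc 0 t s -> g s <> RtoC (lambda s);
  loewner_ode : forall s, Icc 0 t s ->
    is_derive_within (Icc 0 t) g s (RtoC 2 / (g s - RtoC (lambda s)))%C
}.

Definition loewner_domain (lambda : R -> R) (t : R) : C -> Prop :=
  fun z => upper_half_plane z /\ exists g, loewner_solution lambda t z g.

Record generates_slit (T : R) (lambda : R -> R) (gamma : R -> C) : Prop := {
  slit_continuous : continuous_on (Icc 0 T) gamma;
  slit_simple : forall s t, Icc 0 T s -> Icc 0 T t -> gamma s = gamma t -> s = t;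
  slit_start : gamma 0 = RtoC (lambda 0);
  slit_upper : forall t, 0 < t <= T -> upper_half_plane (gamma t);
  slit_domain : forall t, Icc 0 T t -> forall z,
    loewner_domain lambda t z <->
    upper_half_plane z /\ ~ (exists s, Icc 0 t s /\ z = gamma s)
}.

(* |x - y|^(1/2) is [sqrt], since [Rpower 0 (1/2)] is not 0. *)
Definition half_holder_one (T : R) (lambda : R -> R) : Prop :=
  forall t1 t2, Icc 0 T t1 -> Icc 0 T t2 ->
    Rabs (lambda t1 - lambda t2) <= sqrt (Rabs (t1 - t2)).

Definition sup_on (D : R -> Prop) (f : R -> R) : Rbar :=
  Lub_Rbar (fun x => exists t, D t /\ x = f t).

(* Main.v *)
Require Import Defs.
From Stdlib Require Import Reals Lra Lia.
From Coquelicot Require Import Coquelicot.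

Open Scope R_scope.

(** Run time backwards from [t]: with [xi r = lambda (t - r)], the point
    [gamma t] is the value at time [t] of the flow [df/dr = -2 / (f - xi)] that
    starts at the singularity [f 0 = xi 0 = lambda t].  So two slits are
    compared by comparing two such flows, and the estimate rests on a cone
    condition for [w = f - xi].

    The real part of [f] is always pulled towards [xi], hence it stays within
    the range of [xi] on [[0, s]], and the bound [1] on the Hoelder seminorm
    gives [|Re w| <= sqrt s] ([reverse_flow_Re_near]).  Inserted in the equation
    for the imaginary part this gives [(Im w)^2 >= 3 s]
    ([reverse_flow_Im_growth]).  Thus [w] makes an angle of at most 30 degrees
    with the imaginary axis.  For two flows [f], [f'], driven by [xi], [xi'], the
    difference [d = f - f'] has the derivative [2 (d - (xi - xi')) / (w w')] with
    [w' = f' - xi'], and [w w'] lies within 60 degrees of the negative real axis, so that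
    [Re (1 / (w w')) <= -1/2 |1 / (w w')|].  Hence [|d|] cannot increase while
    [|d| >= 2 |xi - xi'|] ([cone_contraction]), and a bound [2 sup |xi - xi'|]
    on [|d|], true at time [0], persists: the constant of the theorem is [2].

    The flow from the singularity is obtained as the limit of the flows started
    at [xi 0 + i y], as [y] tends to [0].  Those exist by Picard iteration, since
    the imaginary part increases and the field is Lipschitz on [Im z >= y]; they
    converge uniformly, by the same comparison with [xi' = xi].  The limit is
    again a solution for positive times ([tip_flow_spec]).

    Let [z] be the value of this limit flow at time [t].  Read forwards it is a
    Loewner solution started at [z] on every [[0, s]] with [s < t], so [z] is in
    the domain at time [s] and differs from [gamma s].  A solution up to time [t]
    would agree with it by uniqueness and so hit [lambda t] at time [t]; hence
    [z] is not in the domain at time [t].  As the complement of that domain is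
    the slit up to [t], [z = gamma t] ([slit_eq_tip_flow]). *)

(** * Distances in complete normed modules *)

Definition dist {V : NormedModule R_AbsRing} (x y : V) : R := norm (minus x y).

Lemma dist_sym {V : NormedModule R_AbsRing} (x y : V) : dist x y = dist y x.
Proof. unfold dist. rewrite <- (norm_opp (minus x y)). now rewrite opp_minus. Qed.

Lemma dist_triangle {V : NormedModule R_AbsRing} (x y z : V) :
  dist x z <= dist x y + dist y z.
Proof.
  unfold dist. rewrite (minus_trans y x z). apply (norm_triangle (minus x y)).
Qed.

Lemma dist_pos {V : NormedModule R_AbsRing} (x y : V) : 0 <= dist x y.
Proof. apply norm_ge_0. Qed.

Lemma dist_refl {V : NormedModule R_AbsRing} (x : V) : dist x x = 0.
Proof. unfold dist. rewrite minus_eq_zero. apply norm_zero. Qed.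

Lemma dist_eq {V : NormedModule R_AbsRing} (x y : V) :
  (forall e, 0 < e -> dist x y <= e) -> x = y.
Proof.
  intros H.
  assert (E : dist x y = 0).
  { apply Rle_antisym; [|apply dist_pos]. apply le_epsilon. intros e he.
    rewrite Rplus_0_l. auto. }
  apply norm_eq_zero in E.
  apply (plus_reg_r (opp y)). rewrite plus_opp_r. exact E.
Qed.

Lemma minus_plus_plus {G : AbelianGroup} (x y z w : G) :
  minus (plus x y) (plus z w) = plus (minus x z) (minus y w).
Proof.
  unfold minus. rewrite opp_plus, <- !plus_assoc. f_equal.
  rewrite !plus_assoc. f_equal. apply plus_comm.
Qed.

Lemma dist_plus {V : CompleteNormedModule R_AbsRing} (x y z w : V) :
  dist (plus x y) (plus z w) <= dist x z + dist y w.
Proof.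
  apply Rle_trans with (2 := norm_triangle (V := V) (minus x z) (minus y w)).
  right. apply (f_equal norm). exact (minus_plus_plus (G := V) x y z w).
Qed.

Lemma dist_zero {V : CompleteNormedModule R_AbsRing} (x : V) : dist x zero = norm x.
Proof. apply (f_equal norm). apply (minus_zero_r (G := V)). Qed.

Lemma continuous_dist {V : CompleteNormedModule R_AbsRing} (f : R -> V) (s : R) :
  continuous f s <->
  forall e, 0 < e -> exists d, 0 < d /\ forall r, Rabs (r - s) < d -> dist (f r) (f s) < e.
Proof.
  unfold continuous. split.
  - intros H e he.
    assert (H1 := H _ (locally_ball_norm (V := V) (f s) (mkposreal e he))).
    destruct H1 as [d Hd]. exists d. split; [apply cond_pos|].
    intros r Hr. apply (Hd r Hr).
  - intros H. apply (filterlim_locally_ball_norm (U := V)). intros e.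
    destruct (H e (cond_pos e)) as [d [hd Hd]].
    exists (mkposreal d hd). intros r Hr. apply (Hd r Hr).
Qed.

Lemma continuous_uniform_limit {V : CompleteNormedModule R_AbsRing} (f : R -> V) (s : R) :
  (forall e, 0 < e -> exists phi, continuous phi s /\ forall r, dist (phi r) (f r) <= e) ->
  continuous f s.
Proof.
  intros H. apply continuous_dist. intros e he.
  destruct (H (e / 4)) as [phi [Hc Hd]]; [lra|].
  destruct (proj1 (continuous_dist phi s) Hc (e/4)) as [d [hd Hd']]; [lra|].
  exists d. split; [easy|]. intros r hr.
  pose proof (dist_triangle (f r) (phi r) (f s)).
  pose proof (dist_triangle (phi r) (phi s) (f s)).
  specialize (Hd' r hr). pose proof (Hd r). pose proof (Hd s).
  rewrite (dist_sym (f r) (phi r)) in H0. lra.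
Qed.

Definition seq_lim {V : CompleteNormedModule R_AbsRing} (u : nat -> V) : V :=
  lim (filtermap u eventually).

Lemma half_pow_pos n : 0 < (/2) ^ n.
Proof. apply pow_lt. lra. Qed.

Lemma half_pow_small K e : 0 < e -> exists n, K * (/2) ^ n <= e.
Proof.
  intros he.
  destruct (pow_lt_1_zero (/2)) with (y := e / (Rabs K + 1)) as [n Hn].
  - rewrite Rabs_pos_eq; lra.
  - pose proof (Rabs_pos K). apply Rdiv_lt_0_compat; lra.
  - exists n. specialize (Hn n (le_n n)).
    pose proof (half_pow_pos n). rewrite Rabs_pos_eq in Hn by lra.
    pose proof (Rabs_pos K). pose proof (Rle_abs K).
    apply (Rlt_div_r _ _ (Rabs K + 1)) in Hn; [|lra].
    assert (K * (/2) ^ n <= Rabs K * (/2) ^ n) by (apply Rmult_le_compat_r; lra). lra.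
Qed.

Lemma geometric_cauchy {V : CompleteNormedModule R_AbsRing} (u : nat -> V) (K : R) :
  (forall n, dist (u (S n)) (u n) <= K * (/2) ^ n) ->
  forall n k, dist (u (k + n)%nat) (u n) <= 2 * K * (/2) ^ n.
Proof.
  intros H n k.
  assert (K0 : 0 <= K).
  { pose proof (H O). pose proof (dist_pos (u 1%nat) (u O)). simpl in H0. lra. }
  assert (dist (u (k + n)%nat) (u n) <= 2 * K * ((/2) ^ n - (/2) ^ (k + n))).
  { induction k as [|k IH].
    - simpl. rewrite dist_refl. lra.
    - pose proof (dist_triangle (u (S (k + n))) (u (k + n)%nat) (u n)).
      pose proof (H (k + n)%nat). change (S k + n)%nat with (S (k + n)). simpl pow. lra. }
  pose proof (half_pow_pos (k + n)). nra.
Qed.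

(** All limits below are geometric, so that an explicit rate is at hand and
    uniform convergence never has to be phrased with filters. *)
Lemma seq_lim_geometric {V : CompleteNormedModule R_AbsRing} (u : nat -> V) (K : R) :
  (forall n, dist (u (S n)) (u n) <= K * (/2) ^ n) ->
  forall n, dist (seq_lim u) (u n) <= 2 * K * (/2) ^ n.
Proof.
  intros H n.
  assert (HC := geometric_cauchy u K H).
  assert (Hcau : cauchy (filtermap u eventually)).
  { intros eps.
    destruct (half_pow_small (2 * K) (eps / 2)) as [N HN].
    { pose proof (cond_pos eps). lra. }
    exists (u N). exists N. intros m hm.
    apply (norm_compat1 (V := V)). replace m with ((m - N) + N)%nat by lia.
    apply Rle_lt_trans with (1 := HC N (m - N)%nat). pose proof (cond_pos eps). lra. }
  apply le_epsilon. intros e he.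
  set (e' := e / @norm_factor R_AbsRing V / 2).
  assert (he' : 0 < e').
  { pose proof (@norm_factor_gt_0 R_AbsRing V). unfold e'.
    apply Rdiv_lt_0_compat; [apply Rdiv_lt_0_compat|]; lra. }
  destruct (complete_cauchy (filtermap u eventually) _ Hcau (mkposreal _ he')) as [N HN].
  pose proof (HN (n + N)%nat ltac:(lia)) as B.
  apply (norm_compat2 (V := V)) in B. simpl in B.
  replace (norm_factor * e') with (e / 2) in B.
  2:{ unfold e'. field. pose proof (@norm_factor_gt_0 R_AbsRing V). lra. }
  pose proof (dist_triangle (seq_lim u) (u (n + N)%nat) (u n)).
  rewrite (dist_sym (seq_lim u) (u (n + N)%nat)) in H0.
  unfold dist in *. unfold seq_lim in *.
  rewrite (Nat.add_comm n N) in *. pose proof (HC n N). lra.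
Qed.

(** * Flows of bounded Lipschitz fields *)

(** The boundedness makes every Picard iterate [M]-Lipschitz in time, so that
    the iterates and their limit are continuous without any localisation. *)
Record lipschitz_field {V : NormedModule R_AbsRing} (F : R -> V -> V) (L M : R) : Prop := {
  field_lipschitz : forall s x y, dist (F s x) (F s y) <= L * dist x y;
  field_bounded : forall s x, norm (F s x) <= M;
  field_continuous : forall f s,
    continuous f s -> continuous (fun r => F r (f r)) s
}.

Section Field.
Context {V : CompleteNormedModule R_AbsRing} {F : R -> V -> V} {L M : R}
  (HF : lipschitz_field F L M).

Lemma field_ex_RInt (f : R -> V) a b :
  (forall s, continuous f s) -> ex_RInt (fun r => F r (f r)) a b.
Proof.
  intros Hf. apply ex_RInt_continuous. intros s _. now apply (field_continuous _ _ _ HF).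
Qed.

Lemma field_RInt_bound (f : R -> V) a b :
  (forall s, continuous f s) ->
  norm (RInt (fun r => F r (f r)) a b) <= M * Rabs (b - a).
Proof.
  intros Hf.
  assert (A : forall a b, a <= b ->
     norm (RInt (fun r => F r (f r)) a b) <= M * (b - a)).
  { clear a b. intros a b hab. rewrite Rmult_comm.
    apply (norm_RInt_le_const (fun r => F r (f r)) a b); [easy| |].
    - intros; apply (field_bounded _ _ _ HF).
    - now apply RInt_correct, field_ex_RInt. }
  destruct (Rle_dec a b) as [h|h].
  - rewrite Rabs_pos_eq by lra. auto.
  - rewrite Rabs_left by lra. rewrite <- opp_RInt_swap by now apply field_ex_RInt.
    apply Rle_trans with (1 := Req_le _ _ (norm_opp (V := V) _)).
    replace (- (b - a)) with (a - b) by ring. apply A. lra.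
Qed.

Definition integral_equation (f : R -> V) (a b : R) : Prop :=
  f b = plus (f a) (RInt (fun r => F r (f r)) a b).

Lemma RInt_field_dist (f g : R -> V) (k : R -> R) a b I :
  (forall s, continuous f s) -> (forall s, continuous g s) -> a <= b -> 0 <= L ->
  (forall r, a <= r <= b -> dist (f r) (g r) <= k r) ->
  is_RInt k a b I ->
  dist (RInt (fun r => F r (f r)) a b) (RInt (fun r => F r (g r)) a b) <= L * I.
Proof.
  intros Hf Hg hab hL Hk HI. 
  apply Rle_trans with (norm (RInt (fun r => minus (F r (f r)) (F r (g r))) a b)).
  { right. apply (f_equal norm). symmetry. apply RInt_minus; now apply field_ex_RInt. }
  apply (norm_RInt_le (fun r => minus (F r (f r)) (F r (g r))) (fun r => L * k r) a b); auto.
  - intros r hr. apply Rle_trans with (1 := field_lipschitz _ _ _ HF r _ _).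
    apply Rmult_le_compat_l; auto.
  - apply RInt_correct. apply (ex_RInt_minus (V := V)); now apply field_ex_RInt.
  - now apply (is_RInt_scal (V := R_NormedModule)).
Qed.

(** The integral equation passes to uniform limits because [F] is uniformly
    Lipschitz in space.  The two approximants [phi] and [psi] are successive
    iterates in the Picard scheme, and the same curve when a limit of exact
    solutions is taken. *)
Lemma integral_equation_closed (f : R -> V) a b :
  a <= b -> 0 <= L -> (forall s, continuous f s) ->
  (forall e, 0 < e -> exists phi psi : R -> V,
     (forall s, continuous phi s) /\
     (forall r, a <= r <= b -> dist (phi r) (f r) <= e /\ dist (psi r) (f r) <= e) /\
     psi b = plus (psi a) (RInt (fun r => F r (phi r)) a b)) ->
  integral_equation f a b.
Proof.
  intros hab hL Hf H. apply dist_eq. intros e he.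
  set (e' := e / (2 + L * (b - a))).
  assert (hLb : 0 <= L * (b - a)) by (apply Rmult_le_pos; lra).
  assert (he' : 0 < e') by (apply Rdiv_lt_0_compat; lra).
  destruct (H e' he') as [phi [psi [Hc [Hd E]]]].
  pose proof (dist_triangle (f b) (psi b) (plus (f a) (RInt (fun r => F r (f r)) a b))).
  assert (dist (psi b) (plus (f a) (RInt (fun r => F r (f r)) a b)) <= e' + L * ((b - a) * e')).
  { rewrite E. apply Rle_trans with (1 := dist_plus _ _ _ _).
    apply Rplus_le_compat.
    - apply Hd; lra.
    - apply (RInt_field_dist phi f (fun _ => e')); auto.
      + intros r hr. now apply Hd.
      + apply (is_RInt_const (V := R_NormedModule)). }
  rewrite dist_sym in H0.
  assert (dist (psi b) (f b) <= e') by (apply Hd; lra).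
  rewrite (dist_sym (f b) (psi b)) in H0.
  apply Rle_trans with (e' * (2 + L * (b - a))); [|unfold e'; right; field; lra].
  rewrite dist_sym. lra.
Qed.

Lemma integral_equation_derive (f : R -> V) a s :
  a < s -> (forall r, continuous f r) ->
  (forall b, a <= b -> integral_equation f a b) ->
  is_derive f s (F s (f s)).
Proof.
  intros has Hf H.
  apply is_derive_ext_loc with (f := fun b => plus (f a) (RInt (fun r => F r (f r)) a b)).
  - assert (hp : 0 < s - a) by lra. exists (mkposreal _ hp).
    intros b hb. apply Rabs_lt_between' in hb. simpl in hb. symmetry. apply H. lra.
  - replace (F s (f s)) with (plus (@zero V) (F s (f s))) by apply plus_zero_l.
    apply (is_derive_plus (V := V) (fun _ => f a) (fun b => RInt (fun r => F r (f r)) a b));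
      [apply (is_derive_const (V := V))|].
    apply (is_derive_RInt (V := V) (fun r => F r (f r)) (fun b => RInt (fun r => F r (f r)) a b) a).
    + apply filter_forall. intros b. now apply (RInt_correct (V := V)), field_ex_RInt.
    + now apply (field_continuous _ _ _ HF).
Qed.

Fixpoint picard (z : V) (n : nat) (s : R) : V :=
  match n with
  | O => z
  | S n => plus z (RInt (fun r => F r (picard z n r)) 0 s)
  end.

Lemma lipschitz_continuous (f : R -> V) :
  (forall a b, dist (f b) (f a) <= M * Rabs (b - a)) -> forall s, continuous f s.
Proof.
  intros H s. apply continuous_dist. intros e he.
  assert (0 < e / (Rabs M + 1)) by (pose proof (Rabs_pos M); apply Rdiv_lt_0_compat; lra).
  exists (e / (Rabs M + 1)). split; [easy|]. intros r hr.
  specialize (H s r). pose proof (Rle_abs M). pose proof (Rabs_pos M).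
  pose proof (Rabs_pos (r - s)). apply (Rlt_div_r _ _ (Rabs M + 1)) in hr; [|lra].
  assert (M * Rabs (r - s) <= Rabs M * Rabs (r - s)) by (apply Rmult_le_compat_r; lra). lra.
Qed.

Lemma field_bound_nonneg : 0 <= M.
Proof. apply Rle_trans with (norm (F 0 zero)); [apply norm_ge_0|apply (field_bounded _ _ _ HF)]. Qed.

Lemma RInt_field_lipschitz (g : R -> V) z a b :
  (forall s, continuous g s) ->
  dist (plus z (RInt (fun r => F r (g r)) 0 b)) (plus z (RInt (fun r => F r (g r)) 0 a))
    <= M * Rabs (b - a).
Proof.
  intros Hg. apply Rle_trans with (1 := dist_plus _ _ _ _). rewrite dist_refl, Rplus_0_l.
  apply Rle_trans with (2 := field_RInt_bound g a b Hg).
  right. apply (f_equal norm).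
  apply (plus_reg_l (G := V) (RInt (fun r => F r (g r)) 0 a)).
  etransitivity; [|symmetry; apply RInt_Chasles; now apply field_ex_RInt].
  unfold minus. etransitivity; [apply (plus_comm (G := V))|].
  etransitivity; [symmetry; apply (plus_assoc (G := V))|].
  etransitivity; [|apply (plus_zero_r (G := V))].
  apply (f_equal (plus _)). apply (plus_opp_l (G := V)).
Qed.

Lemma picard_lipschitz z n a b :
  dist (picard z n b) (picard z n a) <= M * Rabs (b - a).
Proof.
  revert a b. induction n as [|n IH]; intros a b; simpl.
  - rewrite dist_refl. apply Rmult_le_pos; [apply field_bound_nonneg|apply Rabs_pos].
  - apply RInt_field_lipschitz. now apply lipschitz_continuous.
Qed.

Lemma picard_continuous z n s : continuous (picard z n) s.
Proof. apply lipschitz_continuous. apply picard_lipschitz. Qed.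

(** Bielecki's weight: integrating [L exp (2 L r)] gains the factor [1/2] at
    each step, which gives convergence on the whole half-line at once. *)
Lemma picard_step z n s : 0 < L -> 0 <= s ->
  dist (picard z (S n) s) (picard z n s) <= M / (2 * L) * exp (2 * L * s) * (/2) ^ n.
Proof.
  intros hL. revert s. induction n as [|n IH]; intros s hs.
  - simpl. replace z with (plus z zero) at 2 by apply plus_zero_r.
    apply Rle_trans with (1 := dist_plus _ _ _ _). rewrite dist_refl.
    rewrite Rplus_0_l. apply Rle_trans with (1 := Req_le _ _ (dist_zero _)).
    pose proof (field_RInt_bound (fun _ => z) 0 s (fun r => continuous_const z r)).
    rewrite Rabs_pos_eq in H by lra.
    assert (2 * L * s <= exp (2 * L * s)) by (pose proof (exp_ineq1_le (2 * L * s)); lra).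
    pose proof field_bound_nonneg.
    assert (0 <= M / (2 * L)) by (apply Rdiv_le_0_compat; lra).
    replace (M * (s - 0)) with (M / (2 * L) * (2 * L * s)) in H by (field; lra).
    nra.
  - change (picard z (S (S n)) s) with (plus z (RInt (fun r => F r (picard z (S n) r)) 0 s)).
    change (picard z (S n) s) with (plus z (RInt (fun r => F r (picard z n r)) 0 s)).
    apply Rle_trans with (1 := dist_plus _ _ _ _). rewrite dist_refl, Rplus_0_l.
    set (A := M / (2 * L) * (/2) ^ n).
    assert (hA : 0 <= A).
    { pose proof field_bound_nonneg. pose proof (half_pow_pos n).
      apply Rmult_le_pos; [apply Rdiv_le_0_compat|]; lra. }
    apply Rle_trans with (L * (A / (2 * L) * exp (2 * L * s) - A / (2 * L) * exp (2 * L * 0))).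
    + apply RInt_field_dist with (k := fun r => A * exp (2 * L * r));
        try apply picard_continuous; try lra.
      * intros r hr. unfold A. rewrite Rmult_assoc, (Rmult_comm (_ ^ _)), <- Rmult_assoc.
        apply IH. lra.
      * apply (is_RInt_derive (fun r => A / (2 * L) * exp (2 * L * r))).
        -- intros r _. auto_derive; [easy|]. field. lra.
        -- intros r _. apply (ex_derive_continuous (fun r => A * exp (2 * L * r))).
           auto_derive. easy.
    + rewrite Rmult_0_r, exp_0. simpl pow. unfold A in *. 
      replace (L * (M / (2 * L) * (/ 2) ^ n / (2 * L) * exp (2 * L * s) - M / (2 * L) * (/ 2) ^ n / (2 * L) * 1))
        with (M / (2 * L) * exp (2 * L * s) * (/ 2 * (/ 2) ^ n) - M / (2 * L) * (/2)^n / 2) by (field; lra).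
      lra.
Qed.

(** The iterates are controlled for nonnegative times only; before time [0] the
    flow is frozen so that it is continuous on the whole line. *)
Definition ode_flow (z : V) (s : R) : V := seq_lim (fun n => picard z n (Rmax 0 s)).

Theorem ode_flow_solution (z : V) : 0 < L ->
  ode_flow z 0 = z /\ (forall s, continuous (ode_flow z) s) /\
    forall s, 0 < s -> is_derive (ode_flow z) s (F s (ode_flow z s)).
Proof.
  intros hL. set (f := ode_flow z).
  set (K := fun s => M / (2 * L) * exp (2 * L * s)).
  assert (Hlim : forall s n, 0 <= s -> dist (f s) (picard z n s) <= 2 * K s * (/2) ^ n).
  { intros s n hs. unfold f, ode_flow. rewrite Rmax_right by easy.
    apply (seq_lim_geometric (fun n => picard z n s)). intros m. now apply picard_step. }
  assert (Hmax : forall s, f s = f (Rmax 0 s)).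
  { intros s. unfold f, ode_flow. rewrite (Rmax_right 0 (Rmax 0 s)); [easy|apply Rmax_l]. }
  assert (HLip : forall a b, dist (f b) (f a) <= M * Rabs (b - a)).
  { intros a b. rewrite (Hmax a), (Hmax b).
    apply Rle_trans with (M * Rabs (Rmax 0 b - Rmax 0 a)).
    2:{ apply Rmult_le_compat_l; [apply field_bound_nonneg|].
        unfold Rmax, Rabs. repeat destruct Rle_dec; repeat destruct Rcase_abs; lra. }
    assert (ha := Rmax_l 0 a). assert (hb := Rmax_l 0 b).
    set (a' := Rmax 0 a) in *. set (b' := Rmax 0 b) in *.
    apply le_epsilon. intros e he.
    destruct (half_pow_small (2 * K a' + 2 * K b') e he) as [n Hn].
    pose proof (Hlim a' n ha). pose proof (Hlim b' n hb).
    pose proof (dist_triangle (f b') (picard z n b') (f a')).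
    pose proof (dist_triangle (picard z n b') (picard z n a') (f a')).
    pose proof (picard_lipschitz z n a' b').
    rewrite (dist_sym (picard z n a')) in H2. lra. }
  assert (Hc := lipschitz_continuous f HLip).
  assert (H0 : f 0 = z).
  { apply dist_eq. intros e he.
    destruct (half_pow_small (2 * K 0) e he) as [n Hn].
    replace z with (picard z n 0). { pose proof (Hlim 0 n (Rle_refl 0)). lra. }
    destruct n; simpl; [easy|]. rewrite RInt_point. apply plus_zero_r. }
  split; [easy|]. split; [easy|]. intros s hs.
  apply (integral_equation_derive f 0 s hs Hc). intros b hb.
  apply integral_equation_closed; auto; [lra|]. intros e he.
  destruct (half_pow_small (2 * K b) e he) as [n Hn].
  assert (HKb : forall r m, (n <= m)%nat -> 0 <= r <= b -> dist (picard z m r) (f r) <= e).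
  { intros r m hm hr. rewrite dist_sym. apply Rle_trans with (1 := Hlim r m (proj1 hr)).
    apply Rle_trans with (2 := Hn).
    assert (K r <= K b).
    { apply Rmult_le_compat_l.
      - pose proof field_bound_nonneg. apply Rdiv_le_0_compat; lra.
      - destruct (Req_dec r b) as [->|]; [lra|]. left. apply exp_increasing. nra. }
    assert (0 <= K r).
    { apply Rmult_le_pos.
      - pose proof field_bound_nonneg. apply Rdiv_le_0_compat; lra.
      - left; apply exp_pos. }
    assert ((/2) ^ m <= (/2) ^ n).
    { replace m with ((m - n) + n)%nat by lia. rewrite pow_add.
      pose proof (half_pow_pos n). assert ((/2) ^ (m - n) <= 1); [|nra].
      rewrite <- (pow1 (m - n)). apply pow_incr. lra. }
    pose proof (half_pow_pos m). pose proof (half_pow_pos n). nra. }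
  exists (picard z n), (picard z (S n)). split; [apply picard_continuous|]. split.
  - intros r hr. split; apply HKb; auto.
  - simpl. rewrite RInt_point, plus_zero_r. easy.
Qed.
End Field.

Arguments ode_flow {V} F z s.

(** * A differential inequality *)

Lemma is_derive_pos_part_sq (x : R) : is_derive (fun y => (Rmax 0 y) ^ 2) x (2 * Rmax 0 x).
Proof.
  destruct (Rtotal_order x 0) as [h|[h|h]].
  - rewrite (Rmax_left 0 x) by lra. rewrite Rmult_0_r.
    apply is_derive_ext_loc with (f := fun _ => 0); [|apply is_derive_Reals, derivable_pt_lim_const].
    assert (hp : 0 < - x) by lra. exists (mkposreal _ hp). intros y hy.
    apply Rabs_lt_between' in hy. simpl in hy. rewrite Rmax_left by lra. simpl. ring.
  - subst. rewrite Rmax_left, Rmult_0_r by lra. apply is_derive_Reals.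
    intros e he. exists (mkposreal e he). intros y hy0 hy. simpl in hy.
    rewrite Rplus_0_l, (Rmax_left 0 0), Rminus_0_r by lra.
    replace (Rmax 0 y ^ 2 - 0 ^ 2) with (Rmax 0 y ^ 2) by ring.
    unfold Rdiv. rewrite Rabs_mult, Rabs_inv. 
    apply Rle_lt_trans with (Rabs y); [|easy].
    apply (Rmult_le_reg_r (Rabs y)); [now apply Rabs_pos_lt|].
    rewrite Rmult_assoc, Rinv_l, Rmult_1_r by now apply Rabs_no_R0.
    rewrite Rabs_pos_eq by apply pow2_ge_0.
    unfold Rmax, Rabs. destruct Rle_dec; destruct Rcase_abs; nra.
  - rewrite (Rmax_right 0 x) by lra.
    apply is_derive_ext_loc with (f := fun y => y ^ 2).
    + exists (mkposreal x h). intros y hy.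
      apply Rabs_lt_between' in hy. simpl in hy. rewrite Rmax_right by lra. easy.
    + auto_derive; [easy|ring].
Qed.

(** Gronwall's lemma for the positive part: [(max 0 h)^2 exp (-2 K s)] is
    differentiable and nonincreasing, and it vanishes at [a]. *)
Lemma barrier (h dh : R -> R) (K a b : R) :
  a <= b -> (forall s, a <= s <= b -> continuous h s) ->
  (forall s, a < s < b -> is_derive h s (dh s)) ->
  (forall s, a < s < b -> 0 < h s -> dh s <= K * h s) ->
  h a <= 0 -> h b <= 0.
Proof.
  intros hab Hc Hd Hle Ha.
  set (k := fun s => Rmax 0 (h s) ^ 2 * exp (- 2 * K * s)).
  (* The mean value theorem may return an endpoint, where [h] need not be
     differentiable, so the derivative is set to [0] there. *)
  set (dk := fun s => if Rlt_dec a s then if Rlt_dec s b then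
     2 * Rmax 0 (h s) * (dh s - K * Rmax 0 (h s)) * exp (- 2 * K * s) else 0 else 0).
  destruct (MVT_gen k a b dk) as [c [_ E]].
  - rewrite Rmin_left, Rmax_right by easy. intros s hs. unfold dk.
    destruct Rlt_dec; [|lra]. destruct Rlt_dec; [|lra].
    assert (D := is_derive_comp (fun y => Rmax 0 y ^ 2) h s _ _
       (is_derive_pos_part_sq (h s)) (Hd s hs)).
    assert (D2 : is_derive (fun s => exp (- 2 * K * s)) s (- 2 * K * exp (- 2 * K * s))).
    { auto_derive; [easy|ring]. }
    evar_last; [apply (is_derive_mult _ _ _ _ _ D D2)|].
    + intros; apply Rmult_comm.
    + unfold plus, mult, scal; simpl; unfold mult; simpl. ring.
  - rewrite Rmin_left, Rmax_right by easy. intros s hs.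
    apply continuity_pt_filterlim. apply (continuous_mult (K := R_AbsRing)).
    + apply (continuous_comp h (fun y => Rmax 0 y ^ 2)); [now apply Hc|].
      apply (ex_derive_continuous (fun y => Rmax 0 y ^ 2)). eexists; apply is_derive_pos_part_sq.
    + apply (ex_derive_continuous (fun s => exp (- 2 * K * s))). auto_derive. easy.
  - assert (hk : k b <= 0).
    { assert (Ea : k a = 0) by (unfold k; rewrite Rmax_left by easy; simpl; ring).
      rewrite Ea in E. assert (dk c <= 0).
      { unfold dk. destruct Rlt_dec; [|lra]. destruct Rlt_dec; [|lra].
        assert (P := exp_pos (- 2 * K * c)). destruct (Rle_lt_dec (h c) 0) as [hc|hc].
        - rewrite Rmax_left by easy. lra.
        - rewrite Rmax_right by lra. pose proof (Hle c ltac:(lra) hc).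
          assert (0 < h c * exp (-2 * K * c)) by nra. nra. }
      nra. }
    apply Rnot_lt_le. intros hb.
    assert (0 < k b); [|lra]. unfold k. rewrite Rmax_right by lra.
    apply Rmult_lt_0_compat; [nra|apply exp_pos].
Qed.

(** * Real coordinates of complex curves *)

(** The completeness structure over the normed module of the derivatives. *)
Notation CV := C_R_CompleteNormedModule.

Lemma dist_Cmod (z w : C) : dist (V := CV) z w = Cmod (z - w)%C.
Proof.
  unfold dist, norm, Cmod. simpl. unfold prod_norm. simpl. unfold norm; simpl. unfold abs; simpl.
  f_equal. rewrite !Rmult_1_r, <- !Rabs_mult, !Rabs_pos_eq by apply Rle_0_sqr. reflexivity.
Qed.

Lemma is_derive_Re (f : R -> C) s l :
  is_derive (V := C_R_NormedModule) f s l -> is_derive (fun r => Re (f r)) s (Re l).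
Proof.
  intros H. unfold is_derive in *.
  apply (filterdiff_comp' (U := R_NormedModule) (V := C_R_NormedModule) f fst s _ fst H).
  apply filterdiff_linear, is_linear_fst.
Qed.

Lemma is_derive_Im (f : R -> C) s l :
  is_derive (V := C_R_NormedModule) f s l -> is_derive (fun r => Im (f r)) s (Im l).
Proof.
  intros H. unfold is_derive in *.
  apply (filterdiff_comp' (U := R_NormedModule) (V := C_R_NormedModule) f snd s _ snd H).
  apply filterdiff_linear, is_linear_snd.
Qed.

Lemma continuous_Re (f : R -> C) s : continuous f s -> continuous (fun r => Re (f r)) s.
Proof. intros H. apply (continuous_comp f fst); [easy|]. apply continuous_fst. Qed.

Lemma continuous_Im (f : R -> C) s : continuous f s -> continuous (fun r => Im (f r)) s.
Proof. intros H. apply (continuous_comp f snd); [easy|]. apply continuous_snd. Qed.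

Definition norm2 (z : C) : R := Re z ^ 2 + Im z ^ 2.

Lemma Cmod_norm2 (z : C) : Cmod z ^ 2 = norm2 z.
Proof.
  unfold Cmod, norm2, Re, Im. apply pow2_sqrt.
  pose proof (pow2_ge_0 (fst z)). pose proof (pow2_ge_0 (snd z)). lra.
Qed.

Lemma norm2_pos (z : C) : z <> RtoC 0 -> 0 < norm2 z.
Proof. intros h. rewrite <- Cmod_norm2. apply pow_lt. apply -> Cmod_gt_0. exact h. Qed.

Lemma Cmod_le_norm2 (z : C) m : 0 <= m -> norm2 z <= m ^ 2 -> Cmod z <= m.
Proof.
  intros hm. rewrite <- Cmod_norm2. intros H.  pose proof (Cmod_ge_0 z). nra.
Qed.

Lemma is_derive_norm2 (f g : R -> C) s l m :
  is_derive (V := C_R_NormedModule) f s l -> is_derive (V := C_R_NormedModule) g s m ->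
  is_derive (fun r => norm2 (f r - g r)%C) s (2 * Re ((l - m) * Cconj (f s - g s))%C).
Proof.
  intros Hf Hg.
  pose proof (is_derive_Re _ _ _ Hf) as F1. pose proof (is_derive_Im _ _ _ Hf) as F2.
  pose proof (is_derive_Re _ _ _ Hg) as G1. pose proof (is_derive_Im _ _ _ Hg) as G2.
  set (x := fun r => Re (f r)) in *. set (y := fun r => Im (f r)) in *.
  set (u := fun r => Re (g r)) in *. set (v := fun r => Im (g r)) in *.
  apply is_derive_ext with (f := fun r => (x r - u r) ^ 2 + (y r - v r) ^ 2).
  { intros r. reflexivity. }
  replace (2 * _) with (2 * (x s - u s) * (Re l - Re m) + 2 * (y s - v s) * (Im l - Im m)).
  2:{ unfold x, y, u, v, Re, Im, Cminus, Cplus, Copp, Cmult, Cconj; simpl; ring. }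
  change (is_derive x s (Re l)) in F1. change (is_derive y s (Im l)) in F2.
  change (is_derive u s (Re m)) in G1. change (is_derive v s (Im m)) in G2.
  clearbody x y u v. auto_derive.
  - repeat split; try (eexists; eassumption).
  - change (fun r => x r) with x. change (fun r => y r) with y.
    change (fun r => u r) with u. change (fun r => v r) with v.
    rewrite (is_derive_unique _ _ _ F1), (is_derive_unique _ _ _ F2),
      (is_derive_unique _ _ _ G1), (is_derive_unique _ _ _ G2). ring.
Qed.

Lemma continuous_norm2 (f g : R -> C) s :
  continuous f s -> continuous g s -> continuous (fun r => norm2 (f r - g r)%C) s.
Proof.
  intros Hf Hg.
  assert (F1 := continuous_Re _ _ Hf). assert (F2 := continuous_Im _ _ Hf).
  assert (G1 := continuous_Re _ _ Hg). assert (G2 := continuous_Im _ _ Hg).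
  apply continuous_ext with (f := fun r => (Re (f r) - Re (g r)) * (Re (f r) - Re (g r))
     + (Im (f r) - Im (g r)) * (Im (f r) - Im (g r))).
  { intros r. unfold norm2, Re, Im, Cminus, Cplus, Copp; simpl. unfold Rminus. ring. }
  apply (continuous_plus (V := R_NormedModule)); apply (continuous_mult (K := R_AbsRing));
   now apply (continuous_minus (V := R_NormedModule)).
Qed.

(** * The Loewner vector field *)

Lemma RtoC_minus_two : RtoC (-2) = (- RtoC 2)%C.
Proof. now rewrite <- RtoC_opp. Qed.

Definition velocity (w : C) : C := (RtoC (-2) / w)%C.

Lemma Re_velocity w : Re (velocity w) = - (2 * Re w / norm2 w).
Proof. unfold velocity, norm2, Cdiv, Cinv, Cmult, Re, Im, RtoC; simpl. unfold Rdiv. ring. Qed.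

Lemma Im_velocity w : Im (velocity w) = 2 * Im w / norm2 w.
Proof. unfold velocity, norm2, Cdiv, Cinv, Cmult, Re, Im, RtoC; simpl. unfold Rdiv. ring. Qed.

Lemma norm2_upper_pos w : 0 < Im w -> 0 < norm2 w.
Proof. unfold norm2. nra. Qed.

Lemma Re_minus_real z a : Re (z - RtoC a)%C = Re z - a.
Proof. reflexivity. Qed.

Lemma Im_minus_real z a : Im (z - RtoC a)%C = Im z.
Proof. unfold Im, Cminus, Cplus, Copp, RtoC; simpl. ring. Qed.

Lemma Cmod_ge_Im z : Im z <= Cmod z.
Proof.
  apply Rle_trans with (1 := Rle_abs _). apply Rle_trans with (2 := Rmax_Cmod z).
  apply Rmax_r.
Qed.

Lemma velocity_lipschitz m w w' : 0 < m -> m <= Im w -> m <= Im w' ->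
  Cmod (velocity w - velocity w') <= 2 / m ^ 2 * Cmod (w - w').
Proof.
  intros hm hw hw'.
  assert (P := Cmod_ge_Im w). assert (P' := Cmod_ge_Im w').
  assert (N : w <> RtoC 0) by (apply Cmod_gt_0; lra).
  assert (N' : w' <> RtoC 0) by (apply Cmod_gt_0; lra).
  replace (velocity w - velocity w')%C with (RtoC 2 * (w - w') / (w * w'))%C
    by (unfold velocity; rewrite RtoC_minus_two; field; auto).
  rewrite Cmod_div by now apply Cmult_neq_0.
  rewrite !Cmod_mult, Cmod_R, Rabs_pos_eq by lra.
  unfold Rdiv. rewrite Rmult_assoc, (Rmult_comm _ (/ _)), <- Rmult_assoc.
  apply Rmult_le_compat_r; [apply Cmod_ge_0|]. apply Rmult_le_compat_l; [lra|].
  apply Rinv_le_contravar; [nra|]. simpl. nra.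
Qed.

(** Raising the imaginary part to at least [m] keeps [z - xi] away from [0], so
    that the Loewner field becomes bounded and globally Lipschitz; it does not
    change a curve that stays in [Im z >= m]. *)
Definition floor_im (m : R) (z : C) : C := (Re z, Rmax m (Im z)).

Lemma floor_im_id m z : m <= Im z -> floor_im m z = z.
Proof. intros h. unfold floor_im. rewrite Rmax_right by easy. now destruct z. Qed.

Lemma floor_im_lipschitz m z w : Cmod (floor_im m z - floor_im m w) <= Cmod (z - w).
Proof.
  apply Cmod_le_norm2; [apply Cmod_ge_0|]. rewrite Cmod_norm2.
  unfold norm2, floor_im, Re, Im, Cminus, Cplus, Copp; simpl.
  apply Rplus_le_compat_l. rewrite !Rmult_1_r. apply Rsqr_le_abs_1.
  unfold Rmax, Rabs. repeat destruct Rle_dec; repeat destruct Rcase_abs; lra.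
Qed.

Definition reversed_field (xi : R -> R) (m s : R) (z : C) : C :=
  velocity (floor_im m z - RtoC (xi s)).

Lemma Im_floor_im_ge m z a : m <= Im (floor_im m z - RtoC a)%C.
Proof. rewrite Im_minus_real. apply Rmax_l. Qed.

Lemma reversed_field_dist xi m r s z w : 0 < m ->
  Cmod (reversed_field xi m r z - reversed_field xi m s w)
    <= 2 / m ^ 2 * (Cmod (z - w) + Rabs (xi r - xi s)).
Proof.
  intros hm.
  apply Rle_trans with (1 := velocity_lipschitz m _ _ hm (Im_floor_im_ge _ _ _) (Im_floor_im_ge _ _ _)).
  apply Rmult_le_compat_l.
  { apply Rdiv_le_0_compat; [lra|]. now apply pow_lt. }
  replace (floor_im m z - RtoC (xi r) - (floor_im m w - RtoC (xi s)))%C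
    with (floor_im m z - floor_im m w + RtoC (-(xi r - xi s)))%C
    by (rewrite RtoC_opp, RtoC_minus; ring).
  apply Rle_trans with (1 := Cmod_triangle _ _). apply Rplus_le_compat.
  - apply floor_im_lipschitz.
  - rewrite Cmod_R, Rabs_Ropp. lra.
Qed.

Definition global_half_holder (xi : R -> R) : Prop :=
  forall a b, Rabs (xi a - xi b) <= sqrt (Rabs (a - b)).

Lemma half_holder_continuous xi : global_half_holder xi ->
  forall s e, 0 < e -> exists d, 0 < d /\ forall r, Rabs (r - s) < d -> Rabs (xi r - xi s) < e.
Proof.
  intros H s e he. exists (e * e). split; [nra|]. intros r hr.
  apply Rle_lt_trans with (1 := H r s). rewrite <- (sqrt_square e) by lra.
  apply sqrt_lt_1; [apply Rabs_pos|nra|easy].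
Qed.

Lemma reversed_field_lipschitz xi m : global_half_holder xi -> 0 < m ->
  lipschitz_field (V := CV) (reversed_field xi m) (2 / m ^ 2) (2 / m).
Proof.
  intros H hm. 
  assert (hK : 0 < 2 / m ^ 2) by (apply Rdiv_lt_0_compat; [lra|now apply pow_lt]).
  split.
  - intros s x y. rewrite !dist_Cmod.
    apply Rle_trans with (1 := reversed_field_dist xi m s s x y hm).
    rewrite Rminus_diag, Rabs_R0, Rplus_0_r. lra.
  - intros s x.
    rewrite <- (dist_zero (V := CV) (reversed_field xi m s x)), dist_Cmod.
    set (w := (floor_im m x - RtoC (xi s))%C).
    assert (hw : m <= Im w) by apply Im_floor_im_ge.
    assert (P := Cmod_ge_Im w).
    assert (N : w <> RtoC 0) by (apply Cmod_gt_0; lra).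
    assert (E : (reversed_field xi m s x - zero)%C = velocity w).
    { change (velocity w + - RtoC 0 = velocity w)%C. ring. }
    apply Rle_trans with (1 := Req_le _ _ (f_equal Cmod E)).
    unfold velocity. rewrite Cmod_div by easy. rewrite Cmod_R, Rabs_left by lra.
    replace (- -2) with 2 by ring. apply Rmult_le_compat_l; [lra|].
    apply Rinv_le_contravar; lra.
  - intros f s Hf. apply (continuous_dist (V := CV)). intros e he.
    set (e' := e / (2 / m ^ 2) / 2).
    assert (he' : 0 < e') by (unfold e'; apply Rdiv_lt_0_compat; [apply Rdiv_lt_0_compat|]; lra).
    destruct (proj1 (continuous_dist (V := CV) f s) Hf e' he') as [d [hd Hd]].
    destruct (half_holder_continuous xi H s e' he') as [d' [hd' Hd']].
    exists (Rmin d d'). split; [now apply Rmin_pos|]. intros r hr.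
    specialize (Hd r (Rlt_le_trans _ _ _ hr (Rmin_l _ _))).
    specialize (Hd' r (Rlt_le_trans _ _ _ hr (Rmin_r _ _))).
    rewrite dist_Cmod in *.
    apply Rle_lt_trans with (1 := reversed_field_dist xi m r s (f r) (f s) hm).
    apply Rlt_le_trans with (2 / m ^ 2 * (e' + e')).
    + apply Rmult_lt_compat_l; lra.
    + right. unfold e'. field. lra.
Qed.

(** * The time-reversed Loewner flow *)

(** Positivity of the imaginary part is asked for positive times only, and the
    equation too: this admits [y = 0], the flow started at the singularity. *)
Record reverse_flow (xi : R -> R) (y : R) (f : R -> C) : Prop := {
  flow_continuous : forall s, continuous f s;
  flow_start : f 0 = (xi 0, y);
  flow_ode : forall s, 0 < s ->
    is_derive (V := C_R_NormedModule) f s (velocity (f s - RtoC (xi s)));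
  flow_upper : forall s, 0 < s -> 0 < Im (f s)
}.

Lemma Im_nondecreasing (f l : R -> C) s :
  (forall r, continuous f r) ->
  (forall r, 0 < r -> is_derive (V := C_R_NormedModule) f r (l r)) ->
  (forall r, 0 < r -> 0 <= Im (l r)) ->
  0 <= s -> Im (f 0) <= Im (f s).
Proof.
  intros Hc Hd Hl hs. apply Rminus_le.
  apply (barrier (fun r => Im (f 0) - Im (f r)) (fun r => - Im (l r)) 0 0 s hs).
  - intros r _. apply (continuous_minus (V := R_NormedModule)); [apply continuous_const|].
    apply continuous_Im, Hc.
  - intros r hr. evar_last.
    + apply (is_derive_minus (V := R_NormedModule)); [apply (is_derive_const (V := R_NormedModule))|].
      apply is_derive_Im, Hd. lra.
    + unfold minus, plus, opp, zero; simpl. ring.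
  - intros r hr _. specialize (Hl r ltac:(lra)). lra.
  - lra.
Qed.

Lemma Im_velocity_pos w : 0 < Im w -> 0 < Im (velocity w).
Proof.
  intros h. rewrite Im_velocity. apply Rdiv_lt_0_compat; [lra|]. now apply norm2_upper_pos.
Qed.

Lemma reverse_flow_Im_ge xi y f s : reverse_flow xi y f -> 0 <= s -> y <= Im (f s).
Proof.
  intros H hs. replace y with (Im (f 0)) by now rewrite (flow_start _ _ _ H).
  apply (Im_nondecreasing f (fun r => velocity (f r - RtoC (xi r)))); auto.
  - apply H.
  - apply H.
  - intros r hr. left. apply Im_velocity_pos. rewrite Im_minus_real. now apply (flow_upper _ _ _ H).
Qed.

Definition reverse_flow_from (xi : R -> R) (y : R) : R -> C :=
  ode_flow (V := CV) (reversed_field xi y) (xi 0, y).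

Lemma reverse_flow_from_spec xi y : global_half_holder xi -> 0 < y ->
  reverse_flow xi y (reverse_flow_from xi y).
Proof.
  intros H hy.
  destruct (ode_flow_solution (reversed_field_lipschitz xi y H hy) (xi 0, y)) as [H0 [Hc Hd]].
  { apply Rdiv_lt_0_compat; [lra|now apply pow_lt]. }
  fold (reverse_flow_from xi y) in *. set (f := reverse_flow_from xi y) in *.
  assert (Hup : forall s, 0 <= s -> y <= Im (f s)).
  { intros s hs. replace y with (Im (f 0)) by now rewrite H0.
    apply (Im_nondecreasing f (fun r => reversed_field xi y r (f r))); auto.
    intros r _. left. apply Im_velocity_pos.
    apply Rlt_le_trans with (1 := hy), Im_floor_im_ge. }
  split; auto.
  - intros s hs. specialize (Hd s hs). unfold reversed_field in Hd.
    rewrite floor_im_id in Hd by (apply Hup; lra). exact Hd.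
  - intros s hs. specialize (Hup s). lra.
Qed.

(** While [Re f] exceeds [xi s + sqrt s], which bounds [xi] on [[0, s]], it lies
    above [xi] and decreases; so it never gets beyond that level. *)
Lemma reverse_flow_Re_near xi y f s : global_half_holder xi -> reverse_flow xi y f -> 0 <= s ->
  Rabs (Re (f s) - xi s) <= sqrt s.
Proof.
  intros H Hf hs.
  assert (Hx : forall r, 0 <= r <= s -> Rabs (xi r - xi s) <= sqrt s).
  { intros r hr. apply Rle_trans with (1 := H r s). apply sqrt_le_1_alt.
    rewrite Rabs_left1; lra. }
  (* Both signs [sg = 1] and [sg = -1] follow from the same argument. *)
  assert (A : forall sg, sg ^ 2 = 1 -> sg * (Re (f s) - xi s) <= sqrt s).
  { intros sg hsg.
    assert (Hx' : forall r, 0 <= r <= s -> sg * (xi r - xi s) <= sqrt s).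
    { intros r hr. specialize (Hx r hr). apply Rle_trans with (2 := Hx).
      assert (E : Rabs sg = 1).
      { rewrite <- sqrt_Rsqr_abs. unfold Rsqr. replace (sg * sg) with 1 by (simpl in hsg; lra). apply sqrt_1. }
      rewrite <- (Rmult_1_l (Rabs _)), <- E, <- Rabs_mult. apply Rle_abs. }
    apply Rminus_le.
    apply (barrier (fun r => sg * (Re (f r) - xi s) - sqrt s)
      (fun r => sg * Re (velocity (f r - RtoC (xi r)))) 0 0 s hs).
    - intros r _. apply (continuous_minus (V := R_NormedModule)); [|apply continuous_const].
      apply (continuous_scal_r (V := R_NormedModule)).
      apply (continuous_minus (V := R_NormedModule)); [|apply continuous_const].
      apply continuous_Re, Hf.
    - intros r hr.
      assert (D := is_derive_Re _ _ _ (flow_ode _ _ _ Hf r ltac:(lra))).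
      evar_last.
      + apply (is_derive_minus (V := R_NormedModule)); [|apply (is_derive_const (V := R_NormedModule))].
        apply (is_derive_scal (fun r => Re (f r) - xi s)).
        apply (is_derive_minus (V := R_NormedModule)); [exact D|apply (is_derive_const (V := R_NormedModule))].
      + unfold minus, plus, opp, zero, scal; simpl. unfold mult; simpl. ring.
    - intros r hr hpos. rewrite Re_velocity, Re_minus_real, Rmult_0_l.
      assert (P := flow_upper _ _ _ Hf r ltac:(lra)).
      rewrite <- (Im_minus_real (f r) (xi r)) in P.
      assert (N := norm2_upper_pos _ P).
      specialize (Hx' r ltac:(lra)).
      assert (0 < 2 * (sg * (Re (f r) - xi r)) / norm2 (f r - xi r)).
      { apply Rdiv_lt_0_compat; lra. }
      unfold Rdiv in *. lra.
    - rewrite (flow_start _ _ _ Hf). simpl. specialize (Hx' 0). lra. }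
  apply Rabs_le. pose proof (A 1 ltac:(ring)). pose proof (A (-1) ltac:(ring)). lra.
Qed.

(** For [w = f - xi] and [u = (Im f)^2] one has
    [du/ds = 4 u / ((Re w)^2 + u) >= 4 u / (s + u)], and [3 s] solves
    the extreme equation [du/ds = 4 u / (s + u)].  The bound [u >= y^2 > 0] bounds
    the factor in [d(3 s - u)/ds <= (3 s - u) / (s + u)]. *)
Lemma reverse_flow_Im_growth xi y f s :
  global_half_holder xi -> 0 < y -> reverse_flow xi y f -> 0 <= s -> 3 * s <= Im (f s) ^ 2.
Proof.
  intros H hy Hf hs. apply Rminus_le.
  apply (barrier (fun r => 3 * r - Im (f r) ^ 2)
    (fun r => 3 - 2 * Im (f r) * Im (velocity (f r - RtoC (xi r)))) (/ y ^ 2) 0 s hs).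
  - intros r _. apply (continuous_minus (V := R_NormedModule)).
    + apply (continuous_scal_r (V := R_NormedModule)), continuous_id.
    + apply (continuous_comp (fun r => Im (f r)) (fun x => x ^ 2)).
      * apply continuous_Im, Hf.
      * apply (ex_derive_continuous (fun x => x ^ 2)). auto_derive. easy.
  - intros r hr.
    assert (D := is_derive_Im _ _ _ (flow_ode _ _ _ Hf r ltac:(lra))).
    set (v := fun r => Im (f r)) in *.
    change (is_derive v r (Im (velocity (f r - RtoC (xi r))))) in D.
    change (is_derive (fun r => 3 * r - v r ^ 2) r (3 - 2 * v r * Im (velocity (f r - RtoC (xi r))))).
    clearbody v. auto_derive; [eexists; exact D|].
    change (fun r => v r) with v. rewrite (is_derive_unique _ _ _ D). ring.
  - intros r hr hpos. rewrite Im_velocity, Im_minus_real.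
    assert (P := reverse_flow_Im_ge _ _ _ r Hf ltac:(lra)).
    assert (Q := reverse_flow_Re_near _ _ _ r H Hf ltac:(lra)).
    assert (X : (Re (f r) - xi r) ^ 2 <= r).
    { apply Rle_trans with (sqrt r ^ 2); [|right; apply pow2_sqrt; lra]. rewrite <- pow2_abs. apply pow_incr.
      split; [apply Rabs_pos|easy]. }
    unfold norm2. rewrite Re_minus_real, Im_minus_real.
    set (v := Im (f r)) in *. set (x := (Re (f r) - xi r) ^ 2) in *.
    assert (x0 : 0 <= x) by apply pow2_ge_0.
    assert (y2 : 0 < y ^ 2) by now apply pow_lt.
    assert (Hv : y ^ 2 <= v ^ 2) by (apply pow_incr; lra).
    replace (2 * v * (2 * v / (x + v ^ 2))) with (4 * v ^ 2 / (x + v ^ 2)) by (field; lra).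
    apply Rle_trans with (3 - 4 * v ^ 2 / (r + v ^ 2)).
    + apply Rplus_le_compat_l, Ropp_le_contravar.
      apply Rmult_le_compat_l; [lra|]. apply Rinv_le_contravar; lra.
    + replace (3 - 4 * v ^ 2 / (r + v ^ 2)) with (/ (r + v ^ 2) * (3 * r - v ^ 2)) by (field; lra).
      apply Rmult_le_compat_r; [lra|]. apply Rinv_le_contravar; lra.
  - assert (P := reverse_flow_Im_ge _ _ _ 0 Hf ltac:(lra)). nra.
Qed.

(** The difference of the velocities is [2 (d - eta) / (w w')].  In the cone
    [Re (w w') <= - |w w'| / 2], so the term in [d] contributes at most
    [- |d|^2 / |w w'|] to its product with the conjugate of [d], and the term in
    [eta] at most [2 |eta| |d| / |w w'|]. *)
Lemma cone_contraction (w w' d : C) (eta m : R) :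
  0 < Im w -> 0 < Im w' -> 3 * Re w ^ 2 <= Im w ^ 2 -> 3 * Re w' ^ 2 <= Im w' ^ 2 ->
  d = (w - w' + RtoC eta)%C -> 2 * Rabs eta <= m -> m ^ 2 <= norm2 d ->
  Re ((velocity w - velocity w') * Cconj d) <= 0.
Proof.
  destruct w as [a b], w' as [a' b'], d as [p q].
  unfold norm2, Re, Im; simpl fst; simpl snd. intros hb hb' hc hc' E he hm.
  unfold Cminus, Cplus, Copp, RtoC in E; simpl in E. injection E as Ep Eq.
  assert (Ea : a = p + a' - eta) by lra. assert (Eb : b = q + b') by lra.
  assert (N : 0 < a ^ 2 + b ^ 2) by nra. assert (N' : 0 < a' ^ 2 + b' ^ 2) by nra.
  (* [A + i B] is the product [w w']. *)
  set (A := a * a' - b * b'). set (B := a * b' + a' * b).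
  assert (EN : A ^ 2 + B ^ 2 = (a ^ 2 + b ^ 2) * (a' ^ 2 + b' ^ 2)) by (unfold A, B; ring).
  set (D := sqrt (p ^ 2 + q ^ 2)). set (P := sqrt (A ^ 2 + B ^ 2)).
  assert (D0 : 0 <= D) by apply sqrt_pos. assert (P0 : 0 <= P) by apply sqrt_pos.
  assert (D2 : D ^ 2 = p ^ 2 + q ^ 2) by (apply pow2_sqrt; nra).
  assert (P2 : P ^ 2 = A ^ 2 + B ^ 2) by (apply pow2_sqrt; nra).
  assert (HA : 2 * A <= - P).
  { assert (a * a' <= b * b' / 3).
    { assert (0 < b * b') by nra.
      assert ((a * a') ^ 2 <= (b * b' / 3) ^ 2).
      { replace ((a * a') ^ 2) with (a ^ 2 * a' ^ 2) by ring.
        replace ((b * b' / 3) ^ 2) with ((b ^ 2 / 3) * (b' ^ 2 / 3)) by field.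
        apply Rmult_le_compat; try apply pow2_ge_0; lra. }
      apply Rnot_lt_le. intros h. nra. }
    assert (A <= - (2 / 3) * (b * b')) by (unfold A; lra).
    assert (P ^ 2 <= (4 / 3 * (b * b')) ^ 2).
    { rewrite P2, EN. replace ((4 / 3 * (b * b')) ^ 2) with ((4 / 3 * b ^ 2) * (4 / 3 * b' ^ 2)) by field.
      apply Rmult_le_compat; lra. }
    assert (0 < b * b') by nra.
    assert (P <= 4 / 3 * (b * b')) by (apply Rnot_lt_le; intros h; nra). lra. }
  assert (HB : Rabs (p * A - q * B) <= D * P).
  { rewrite <- (Rabs_pos_eq (D * P)) by nra. apply Rsqr_le_abs_0.
    unfold Rsqr. assert ((D * P) ^ 2 = (p * A - q * B) ^ 2 + (p * B + q * A) ^ 2).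
    { rewrite Rpow_mult_distr, D2, P2. ring. }
    pose proof (pow2_ge_0 (p * B + q * A)). simpl in *. lra. }
  assert (HD : 2 * Rabs eta <= D).
  { pose proof (Rabs_pos eta). apply Rnot_lt_le. intros h. nra. }
  assert (bracket : (p ^ 2 + q ^ 2) * A - eta * (p * A - q * B) <= 0).
  { assert (- (eta * (p * A - q * B)) <= Rabs eta * (D * P)).
    { apply Rle_trans with (1 := Rle_abs _). rewrite Rabs_Ropp, Rabs_mult.
      apply Rmult_le_compat_l; [apply Rabs_pos|easy]. }
    rewrite <- D2. assert (0 <= D * P) by nra.
    assert (D ^ 2 * (2 * A) <= D ^ 2 * - P) by (apply Rmult_le_compat_l; [apply pow2_ge_0|easy]).
    assert (Rabs eta * (D * P) <= D / 2 * (D * P)) by (apply Rmult_le_compat_r; lra). nra. }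
  apply Rle_trans with (2 / ((a ^ 2 + b ^ 2) * (a' ^ 2 + b' ^ 2)) *
     ((p ^ 2 + q ^ 2) * A - eta * (p * A - q * B))).
  - right.
    unfold velocity, Cdiv, Cinv, Cmult, Cconj, Cminus, Cplus, Copp, RtoC; simpl fst; simpl snd.
    unfold A, B. clear - Ea Eb N N'. subst a b. field. lra.
  - assert (0 < 2 / ((a ^ 2 + b ^ 2) * (a' ^ 2 + b' ^ 2))) by (apply Rdiv_lt_0_compat; nra). nra.
Qed.

Lemma reverse_flow_cone xi y f s :
  global_half_holder xi -> 0 < y -> reverse_flow xi y f -> 0 <= s ->
  3 * Re (f s - RtoC (xi s)) ^ 2 <= Im (f s - RtoC (xi s)) ^ 2.
Proof.
  intros H hy Hf hs. rewrite Re_minus_real, Im_minus_real.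
  apply Rle_trans with (2 := reverse_flow_Im_growth _ _ _ _ H hy Hf hs).
  apply Rmult_le_compat_l; [lra|].
  apply Rle_trans with (sqrt s ^ 2); [|right; now apply pow2_sqrt].
  rewrite <- pow2_abs. apply pow_incr. split; [apply Rabs_pos|].
  now apply (reverse_flow_Re_near xi y).
Qed.

(** Allowing different starting heights [y] and [y'], this one estimate serves
    both for [xi = xi'], where it shows that the flows converge as the height
    tends to [0], and for the comparison of two driving functions. *)
Lemma reverse_flow_comparison xi xi' y y' f f' eps m s :
  global_half_holder xi -> global_half_holder xi' -> 0 < y -> 0 < y' ->
  reverse_flow xi y f -> reverse_flow xi' y' f' -> 0 <= s ->
  (forall r, 0 <= r <= s -> Rabs (xi r - xi' r) <= eps) ->
  0 <= eps -> 2 * eps <= m -> Cmod (f 0 - f' 0) <= m ->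
  Cmod (f s - f' s) <= m.
Proof.
  intros H H' hy hy' Hf Hf' hs He he hm Hm0.
  apply Cmod_le_norm2; [lra|]. apply Rminus_le.
  apply (barrier (fun r => norm2 (f r - f' r) - m ^ 2)
    (fun r => 2 * Re ((velocity (f r - RtoC (xi r)) - velocity (f' r - RtoC (xi' r)))
                * Cconj (f r - f' r))%C) 0 0 s hs).
  - intros r _. apply (continuous_minus (V := R_NormedModule)); [|apply continuous_const].
    apply continuous_norm2; [apply Hf|apply Hf'].
  - intros r hr. evar_last.
    + apply (is_derive_minus (V := R_NormedModule)); [|apply (is_derive_const (V := R_NormedModule))].
      apply is_derive_norm2; [apply (flow_ode _ _ _ Hf)|apply (flow_ode _ _ _ Hf')]; lra.
    + unfold minus, plus, opp, zero; simpl. ring.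
  - intros r hr hpos. rewrite Rmult_0_l.
    assert (C := cone_contraction (f r - RtoC (xi r)) (f' r - RtoC (xi' r)) (f r - f' r)
      (xi r - xi' r) m).
    enough (Re ((velocity (f r - RtoC (xi r)) - velocity (f' r - RtoC (xi' r)))
                * Cconj (f r - f' r))%C <= 0) by lra.
    apply C.
    + rewrite Im_minus_real. apply (flow_upper _ _ _ Hf). lra.
    + rewrite Im_minus_real. apply (flow_upper _ _ _ Hf'). lra.
    + apply (reverse_flow_cone xi y); auto; lra.
    + apply (reverse_flow_cone xi' y'); auto; lra.
    + rewrite RtoC_minus. ring.
    + specialize (He r ltac:(lra)). lra.
    + lra.
  - rewrite <- Cmod_norm2. apply Rle_minus. apply pow_incr. split; [apply Cmod_ge_0|easy].
Qed.

(** * The reversed flow from the singularity *)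

(** The heights [2^-n] make consecutive flows differ by at most [2^-n]. *)
Definition tip_flow (xi : R -> R) (s : R) : C :=
  seq_lim (V := CV) (fun n => reverse_flow_from xi ((/2) ^ n) (Rmax 0 s)).

Lemma Cmod_start_diff (a b y y' : R) : Cmod ((a, y) - (b, y'))%C <= Rabs (a - b) + Rabs (y - y').
Proof.
  replace ((a, y) - (b, y'))%C with (RtoC (a - b) + Ci * RtoC (y - y'))%C.
  - apply Rle_trans with (1 := Cmod_triangle _ _). rewrite Cmod_mult, Cmod_Ci, !Cmod_R. lra.
  - unfold Ci, Cminus, Cplus, Copp, Cmult, RtoC; simpl. f_equal; ring.
Qed.

Lemma tip_flow_approx xi s n : global_half_holder xi -> 0 <= s ->
  Cmod (tip_flow xi s - reverse_flow_from xi ((/2) ^ n) s) <= 2 * (/2) ^ n.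
Proof.
  intros H hs. rewrite <- dist_Cmod. unfold tip_flow. rewrite Rmax_right by easy.
  replace (2 * (/2) ^ n) with (2 * 1 * (/2) ^ n) by ring.
  apply (seq_lim_geometric (V := CV) (fun n => reverse_flow_from xi ((/2) ^ n) s)).
  clear n. intros n. rewrite dist_Cmod, Rmult_1_l.
  assert (P := half_pow_pos n). assert (P' := half_pow_pos (S n)).
  assert (F := reverse_flow_from_spec xi _ H P). assert (F' := reverse_flow_from_spec xi _ H P').
  apply (reverse_flow_comparison xi xi _ _ _ _ 0 _ s H H P' P F' F hs); try lra.
  - intros r _. rewrite Rminus_diag, Rabs_R0. lra.
  - rewrite (flow_start _ _ _ F), (flow_start _ _ _ F').
    apply Rle_trans with (1 := Cmod_start_diff _ _ _ _). rewrite Rminus_diag, Rabs_R0.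
    simpl pow. rewrite Rabs_left1; lra.
Qed.

Lemma tip_flow_comparison xi xi' eps s :
  global_half_holder xi -> global_half_holder xi' -> 0 <= s ->
  (forall r, 0 <= r <= s -> Rabs (xi r - xi' r) <= eps) ->
  Cmod (tip_flow xi s - tip_flow xi' s) <= 2 * eps.
Proof.
  intros H H' hs He.
  assert (he : 0 <= eps) by (apply Rle_trans with (2 := He 0 ltac:(lra)); apply Rabs_pos).
  apply le_epsilon. intros e e0.
  destruct (half_pow_small 4 e e0) as [n Hn].
  assert (A := tip_flow_approx xi s n H hs). assert (A' := tip_flow_approx xi' s n H' hs).
  assert (P := half_pow_pos n).
  assert (F := reverse_flow_from_spec xi _ H P). assert (F' := reverse_flow_from_spec xi' _ H' P).
  assert (B : Cmod (reverse_flow_from xi ((/2) ^ n) s - reverse_flow_from xi' ((/2) ^ n) s) <= 2 * eps).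
  { apply (reverse_flow_comparison xi xi' _ _ _ _ eps _ s H H' P P F F' hs He he); [lra|].
    rewrite (flow_start _ _ _ F), (flow_start _ _ _ F').
    apply Rle_trans with (1 := Cmod_start_diff _ _ _ _). rewrite Rminus_diag, Rabs_R0.
    specialize (He 0). lra. }
  rewrite <- dist_Cmod in *.
  pose proof (dist_triangle (V := CV) (tip_flow xi s) (reverse_flow_from xi ((/2) ^ n) s) (tip_flow xi' s)).
  pose proof (dist_triangle (V := CV) (reverse_flow_from xi ((/2) ^ n) s)
    (reverse_flow_from xi' ((/2) ^ n) s) (tip_flow xi' s)).
  rewrite (dist_sym (V := CV) (tip_flow xi' s)) in A'. lra.
Qed.

Lemma reverse_flow_integral xi y f m a b :
  global_half_holder xi -> reverse_flow xi y f -> 0 < a -> a <= b -> 0 < m ->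
  (forall r, a <= r <= b -> m <= Im (f r)) ->
  integral_equation (V := CV) (F := reversed_field xi m) f a b.
Proof.
  intros H Hf ha hab hm Him.
  assert (HF := reversed_field_lipschitz xi m H hm).
  assert (I : is_RInt (V := CV) (fun r => reversed_field xi m r (f r)) a b (minus (f b) (f a))).
  { apply (is_RInt_derive (V := CV) f); rewrite Rmin_left, Rmax_right by easy; intros r hr.
    - unfold reversed_field. rewrite floor_im_id by now apply Him.
      apply (flow_ode _ _ _ Hf). lra.
    - apply (field_continuous _ _ _ HF). apply Hf. }
  unfold integral_equation. rewrite (is_RInt_unique _ _ _ _ I).
  change (f b = f a + (f b - f a))%C. ring.
Qed.

(** By the growth of the imaginary part, all approximating flows at times
    [>= a > 0] solve an equation with one and the same truncated, globally
    Lipschitz field, and its integral equation survives the limit. *)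
Lemma tip_flow_spec xi : global_half_holder xi -> reverse_flow xi 0 (tip_flow xi).
Proof.
  intros H.
  assert (Hc : forall s, continuous (tip_flow xi) s).
  { intros s. apply (continuous_uniform_limit (V := CV)). intros e he.
    destruct (half_pow_small 2 e he) as [n Hn].
    exists (fun r => reverse_flow_from xi ((/2) ^ n) (Rmax 0 r)). split.
    - apply (continuous_comp (fun r => Rmax 0 r)).
      + apply (continuous_dist (V := R_CompleteNormedModule)). intros e' he'. exists e'. split; [easy|].
        intros r hr. apply Rle_lt_trans with (2 := hr).
        change (Rabs (Rmax 0 r - Rmax 0 s) <= Rabs (r - s)).
        unfold Rmax, Rabs. repeat destruct Rle_dec; repeat destruct Rcase_abs; lra.
      + apply (reverse_flow_from_spec xi _ H (half_pow_pos n)).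
    - intros r. rewrite dist_sym, dist_Cmod.
      apply Rle_trans with (2 := Hn).
      replace (tip_flow xi r) with (tip_flow xi (Rmax 0 r)).
      + apply tip_flow_approx; [easy|apply Rmax_l].
      + unfold tip_flow. rewrite (Rmax_right 0 (Rmax 0 r)); [easy|apply Rmax_l]. }
  assert (Hg : forall s m, 0 < m -> m ^ 2 <= 3 * s ->
     forall n, m <= Im (reverse_flow_from xi ((/2) ^ n) s)).
  { intros s m hm hms n. assert (P := half_pow_pos n).
    assert (hs : 0 < s) by nra.
    assert (G := reverse_flow_Im_growth xi _ _ s H P (reverse_flow_from_spec xi _ H P) ltac:(lra)).
    assert (U := flow_upper _ _ _ (reverse_flow_from_spec xi _ H P) s hs).
    apply Rnot_lt_le. intros h. nra. }
  assert (Hup : forall s m, 0 < m -> m ^ 2 <= 3 * s -> m <= Im (tip_flow xi s)).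
  { intros s m hm hms. apply le_epsilon. intros e he.
    destruct (half_pow_small 2 e he) as [n Hn].
    assert (A := tip_flow_approx xi s n H ltac:(nra)).
    assert (B := Hg s m hm hms n).
    assert (D := Cmod_ge_Im (reverse_flow_from xi ((/2) ^ n) s - tip_flow xi s)).
    rewrite <- dist_Cmod, (dist_sym (V := CV)), dist_Cmod in D.
    unfold Im, Cminus, Cplus, Copp in *; simpl in *. lra. }
  assert (Hpos : forall s, 0 < s -> 0 < Im (tip_flow xi s)).
  { intros s hs. assert (S := sqrt_lt_R0 s hs).
    assert (sqrt s <= Im (tip_flow xi s)); [|lra].
    apply Hup; [easy|]. rewrite pow2_sqrt; lra. }
  split; auto.
  - apply (dist_eq (V := CV)). intros e he.
    destruct (half_pow_small 3 e he) as [n Hn].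
    assert (A := tip_flow_approx xi 0 n H (Rle_refl 0)). assert (P := half_pow_pos n).
    rewrite <- dist_Cmod in A. rewrite (flow_start _ _ _ (reverse_flow_from_spec xi _ H P)) in A.
    pose proof (dist_triangle (V := CV) (tip_flow xi 0) (xi 0, (/2)^n) (xi 0, 0)) as T.
    rewrite (dist_Cmod (xi 0, (/2)^n)) in T.
    pose proof (Cmod_start_diff (xi 0) (xi 0) ((/2)^n) 0) as Q.
    rewrite Rminus_diag, Rabs_R0, Rminus_0_r, (Rabs_pos_eq ((/2)^n)) in Q by lra. lra.
  - intros s hs.
    (* On [[s/2, oo)] the imaginary parts are at least [sqrt (3 s / 2)], hence
       at least [m]. *)
    set (m := sqrt (s / 2)).
    assert (hm : 0 < m) by (apply sqrt_lt_R0; lra).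
    assert (m2 : m ^ 2 = s / 2) by (apply pow2_sqrt; lra).
    assert (HF := reversed_field_lipschitz xi m H hm).
    assert (D : is_derive (V := CV) (tip_flow xi) s (reversed_field xi m s (tip_flow xi s))).
    { apply (integral_equation_derive HF (tip_flow xi) (s / 2) s ltac:(lra) Hc).
      intros b hb. apply (integral_equation_closed HF); auto.
      - apply Rdiv_le_0_compat; [lra|nra].
      - intros e he. destruct (half_pow_small 2 e he) as [n Hn].
        assert (F := reverse_flow_from_spec xi _ H (half_pow_pos n)).
        exists (reverse_flow_from xi ((/2) ^ n)), (reverse_flow_from xi ((/2) ^ n)).
        split; [apply F|]. split.
        + intros r hr. rewrite dist_sym, dist_Cmod.
          assert (A := tip_flow_approx xi r n H ltac:(lra)). lra.
        + apply (reverse_flow_integral xi ((/2) ^ n)); auto; [lra|].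
          intros r hr. apply Hg; lra. }
    unfold reversed_field in D. rewrite floor_im_id in D; [exact D|]. apply Hup; lra.
Qed.

(** * Derivatives relative to a set *)

(** The derivative of a filter is stated at every limit point of the filter; for
    the filters used here the base point is the only one. *)
Lemma within_lim_eq (D : R -> Prop) (x x' : R) :
  D x -> is_filter_lim (T := R_UniformSpace) (within D (locally x)) x' -> x' = x.
Proof.
  intros hD H. apply (dist_eq (V := R_CompleteNormedModule)). intros e he.
  assert (W := H _ (locally_ball x' (mkposreal e he))).
  assert (B := locally_singleton _ _ W hD).
  rewrite dist_sym. left. exact B.
Qed.

Lemma is_derive_within_subset (D D' : R -> Prop) f x l :
  D x -> D' x -> (forall y, D' y -> D y) ->
  is_derive_within D f x l -> is_derive_within D' f x l.
Proof.
  intros hx hx' hs [Hl Hd]. split; [exact Hl|]. intros x' hlim e.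
  rewrite (within_lim_eq D' x x' hx' hlim).
  assert (L : is_filter_lim (T := R_UniformSpace) (within D (locally x)) x).
  { intros P [d HP]. exists d. intros y hy _. now apply HP. }
  destruct (Hd x L e) as [d He]. exists d. intros y hy hD. apply He; auto.
Qed.

Lemma is_derive_to_within (D : R -> Prop) f x l :
  D x -> is_derive (V := C_R_NormedModule) f x l -> is_derive_within D f x l.
Proof.
  intros hx [Hl Hd]. split; [exact Hl|]. intros x' hlim e.
  rewrite (within_lim_eq D x x' hx hlim).
  destruct (Hd x (fun P HP => HP) e) as [d He]. exists d. intros y hy _. now apply He.
Qed.

Lemma is_derive_within_interior (D : R -> Prop) f x l :
  locally x D -> is_derive_within D f x l -> is_derive (V := C_R_NormedModule) f x l.
Proof.
  intros hx [Hl Hd]. split; [exact Hl|]. intros x' hlim e.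
  assert (L : is_filter_lim (T := R_UniformSpace) (within D (locally x)) x').
  { intros P HP. destruct (hlim P HP) as [d He]. exists d. intros y hy _. now apply He. }
  destruct (filter_and _ _ hx (Hd x' L e)) as [d He]. exists d. intros y hy. destruct (He y hy) as [h1 h2]. exact (h2 h1).
Qed.

Lemma is_derive_within_continuous (D : R -> Prop) f x l :
  D x -> is_derive_within D f x l ->
  forall e, 0 < e -> exists d, 0 < d /\
    forall y, D y -> Rabs (y - x) < d -> Cmod (f y - f x) < e.
Proof.
  intros hx [_ Hd] e he.
  assert (L : is_filter_lim (T := R_UniformSpace) (within D (locally x)) x).
  { intros P [d HP]. exists d. intros y hy _. now apply HP. }
  destruct (Hd x L (mkposreal 1 Rlt_0_1)) as [d Hdd].
  set (k := 1 + Cmod l).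
  assert (k0 : 0 < k) by (pose proof (Cmod_ge_0 l); unfold k; lra).
  exists (Rmin d (e / k)). split.
  { apply Rmin_pos; [apply cond_pos|now apply Rdiv_lt_0_compat]. }
  intros y hy hyx.
  assert (A := Hdd y (Rlt_le_trans _ _ _ hyx (Rmin_l _ _)) hy).
  assert (B : Cmod (f y - f x - RtoC (y - x) * l) <= Rabs (y - x)).
  { rewrite <- (Rmult_1_l (Rabs _)). rewrite <- (dist_Cmod (f y - f x)).
    replace (RtoC (y - x) * l)%C with (scal (V := C_R_NormedModule) (y - x) l).
    - exact A.
    - unfold scal; simpl. unfold prod_scal, scal; simpl. unfold mult; simpl.
      unfold Cmult, RtoC; simpl. f_equal; ring. }
  assert (E : Cmod (f y - f x) <= Rabs (y - x) * k).
  { replace (f y - f x)%C with ((f y - f x - RtoC (y - x) * l) + RtoC (y - x) * l)%C by ring.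
    apply Rle_trans with (1 := Cmod_triangle _ _). rewrite Cmod_mult, Cmod_R. unfold k. lra. }
  apply Rle_lt_trans with (1 := E).
  apply (Rlt_div_r _ _ k k0). apply Rlt_le_trans with (1 := hyx), Rmin_r.
Qed.

(** * Uniqueness for the Loewner equation *)

(** Extending by the endpoint values turns functions on [[0, b]] into functions
    on the line, for which two-sided continuity can be used. *)
Definition clamp (b x : R) : R := Rmax 0 (Rmin b x).

Lemma clamp_Icc b x : 0 <= b -> Icc 0 b (clamp b x).
Proof. intros hb. unfold Icc, clamp, Rmax, Rmin. repeat destruct Rle_dec; lra. Qed.

Lemma clamp_id b x : Icc 0 b x -> clamp b x = x.
Proof. unfold Icc, clamp, Rmax, Rmin. repeat destruct Rle_dec; lra. Qed.

Lemma clamp_lipschitz b x y : Rabs (clamp b x - clamp b y) <= Rabs (x - y).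
Proof.
  unfold clamp, Rmax, Rmin, Rabs. repeat destruct Rle_dec; repeat destruct Rcase_abs; lra.
Qed.

Lemma half_holder_clamp T lambda (p : R -> R) : 0 <= T -> half_holder_one T lambda ->
  (forall a b, Rabs (p a - p b) <= Rabs (a - b)) ->
  global_half_holder (fun r => lambda (clamp T (p r))).
Proof.
  intros hT H hp a b. apply Rle_trans with (1 := H _ _ (clamp_Icc T _ hT) (clamp_Icc T _ hT)).
  apply sqrt_le_1_alt. apply Rle_trans with (1 := clamp_lipschitz _ _ _). apply hp.
Qed.

Definition reversal (T : R) (lambda : R -> R) (t r : R) : R := lambda (clamp T (t - r)).

Lemma reversal_half_holder T lambda t : 0 <= T -> half_holder_one T lambda ->
  global_half_holder (reversal T lambda t).
Proof.
  intros hT H. apply (half_holder_clamp T lambda (fun r => t - r)); auto.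
  intros a b. replace (t - a - (t - b)) with (- (a - b)) by ring. rewrite Rabs_Ropp. lra.
Qed.

Lemma reversal_at T lambda t u : Icc 0 T u -> reversal T lambda t (t - u) = lambda u.
Proof.
  intros hu. unfold reversal. replace (t - (t - u)) with u by ring. now rewrite clamp_id.
Qed.

Lemma loewner_solution_restrict lambda s t z g : 0 <= s <= t ->
  loewner_solution lambda t z g -> loewner_solution lambda s z g.
Proof.
  intros hst [H0 Ha Ho]. split; [easy| |].
  - intros r hr. apply Ha. unfold Icc in *. lra.
  - intros r hr. apply (is_derive_within_subset (Icc 0 t)); [| |intros y|apply Ho];
      unfold Icc in *; lra.
Qed.

Lemma loewner_clamp_continuous lambda b z g s : 0 <= b ->
  loewner_solution lambda b z g -> continuous (fun r => g (clamp b r)) s.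
Proof.
  intros hb H. apply (continuous_dist (V := CV)). intros e he.
  destruct (is_derive_within_continuous _ _ _ _ (clamp_Icc b s hb)
    (loewner_ode _ _ _ _ H _ (clamp_Icc b s hb)) e he) as [d [hd Hd]].
  exists d. split; [easy|]. intros r hr. rewrite dist_Cmod. apply Hd; [now apply clamp_Icc|].
  apply Rle_lt_trans with (1 := clamp_lipschitz _ _ _). exact hr.
Qed.

Lemma loewner_clamp_derive lambda b z g s : 0 < s < b ->
  loewner_solution lambda b z g ->
  is_derive (V := C_R_NormedModule) (fun r => g (clamp b r)) s
    (- velocity (g (clamp b s) - RtoC (lambda s)))%C.
Proof.
  intros hs H.
  assert (N : locally s (Icc 0 b)).
  { assert (hp : 0 < Rmin s (b - s)) by (apply Rmin_pos; lra).
    exists (mkposreal _ hp). intros y hy. apply Rabs_lt_between' in hy. simpl in hy.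
    pose proof (Rmin_l s (b - s)). pose proof (Rmin_r s (b - s)). unfold Icc. lra. }
  apply is_derive_ext_loc with (f := g).
  - destruct N as [d N]. exists d. intros y hy. now rewrite clamp_id by now apply N.
  - rewrite clamp_id by (unfold Icc; lra).
    replace (- velocity (g s - RtoC (lambda s)))%C with (RtoC 2 / (g s - RtoC (lambda s)))%C.
    + apply (is_derive_within_interior _ _ _ _ N), H. unfold Icc; lra.
    + unfold velocity, Cdiv. rewrite RtoC_minus_two. ring.
Qed.

Lemma loewner_distance lambda b z g : 0 <= b -> half_holder_one b lambda ->
  loewner_solution lambda b z g ->
  exists c, 0 < c /\ forall s, Icc 0 b s -> c <= norm2 (g s - RtoC (lambda s)).
Proof.
  intros hb Hl H.
  assert (HX := half_holder_clamp b lambda (fun r => r) hb Hl (fun _ _ => Rle_refl _)).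
  set (k := fun r => norm2 (g (clamp b r) - RtoC (lambda (clamp b r)))%C).
  destruct (continuity_ab_min k 0 b hb) as [m [Hm hm]].
  - intros s _. apply continuity_pt_filterlim.
    apply (continuous_norm2 (fun r => g (clamp b r)) (fun r => RtoC (lambda (clamp b r)))).
    + now apply (loewner_clamp_continuous lambda b z g).
    + apply (continuous_dist (V := CV)). intros e he.
      destruct (half_holder_continuous _ HX s e he) as [d [hd Hd]].
      exists d. split; [easy|]. intros r hr. rewrite dist_Cmod, <- RtoC_minus, Cmod_R. now apply Hd.
  - exists (k m). split.
    + unfold k. apply norm2_pos. intros E. apply (loewner_avoid _ _ _ _ H (clamp b m)).
      * now apply clamp_Icc.
      * replace (g (clamp b m)) with (g (clamp b m) - RtoC (lambda (clamp b m)) + RtoC (lambda (clamp b m)))%C by ring.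
        rewrite E. ring.
    + intros s hs. specialize (Hm s hs). unfold k in Hm at 2. rewrite clamp_id in Hm; easy.
Qed.

(** The forward equation spreads solutions apart, but at a bounded rate as long
    as both stay away from the driving point. *)
Lemma velocity_expansion (w w' : C) (c : R) :
  0 < c -> c <= norm2 w -> c <= norm2 w' ->
  2 * Re ((- velocity w - - velocity w') * Cconj (w - w'))%C <= 4 / c * norm2 (w - w')%C.
Proof.
  intros hc hw hw'.
  assert (nz : forall z, c <= norm2 z -> z <> RtoC 0).
  { intros z hz E. subst z. unfold norm2, Re, Im, RtoC in hz; simpl in hz. lra. }
  assert (nw := nz w hw). assert (nw' := nz w' hw').
  set (d := (w - w')%C).
  assert (E : ((- velocity w - - velocity w') = - (RtoC 2 * d / (w * w')))%C).
  { unfold velocity, d. rewrite RtoC_minus_two. field. auto. }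
  assert (M : Cmod ((- velocity w - - velocity w') * Cconj d) <= 2 / c * norm2 d).
  { rewrite E, Cmod_mult, Cmod_opp, Cmod_conj, Cmod_div, !Cmod_mult, Cmod_R, Rabs_pos_eq
      by (try lra; now apply Cmult_neq_0).
    rewrite <- Cmod_norm2.
    replace (2 * Cmod d / (Cmod w * Cmod w') * Cmod d)
      with (2 / (Cmod w * Cmod w') * Cmod d ^ 2).
    2:{ field. split; apply Rgt_not_eq, Cmod_gt_0; easy. }
    apply Rmult_le_compat_r; [apply pow2_ge_0|]. apply Rmult_le_compat_l; [lra|].
    apply Rinv_le_contravar; [easy|].
    rewrite <- Cmod_norm2 in hw, hw'.
    assert (P := proj1 (Cmod_gt_0 w) nw). assert (P' := proj1 (Cmod_gt_0 w') nw').
    apply Rnot_lt_le. intros h.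
    assert (c * c <= Cmod w ^ 2 * Cmod w' ^ 2) by (apply Rmult_le_compat; lra).
    assert (0 < Cmod w * Cmod w') by now apply Rmult_lt_0_compat.
    replace (Cmod w ^ 2 * Cmod w' ^ 2) with ((Cmod w * Cmod w') * (Cmod w * Cmod w')) in H by ring.
    nra. }
  assert (R := re_le_Cmod ((- velocity w - - velocity w') * Cconj d)).
  assert (R' := Rle_abs (Re ((- velocity w - - velocity w') * Cconj d))).
  replace (4 / c * norm2 d) with (2 * (2 / c * norm2 d)) by (field; lra). lra.
Qed.

Lemma loewner_solution_unique lambda b z g h : 0 <= b -> half_holder_one b lambda ->
  loewner_solution lambda b z g -> loewner_solution lambda b z h -> g b = h b.
Proof.
  intros hb Hl Hg Hh.
  destruct (loewner_distance _ _ _ _ hb Hl Hg) as [c [hc Hc]].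
  destruct (loewner_distance _ _ _ _ hb Hl Hh) as [c' [hc' Hc']].
  set (G := fun r => g (clamp b r)). set (H := fun r => h (clamp b r)).
  assert (L : norm2 (G b - H b) <= 0).
  { apply (barrier (fun r => norm2 (G r - H r)%C)
      (fun r => 2 * Re ((- velocity (G r - RtoC (lambda r)) - - velocity (H r - RtoC (lambda r)))
                 * Cconj (G r - H r))%C) (4 / Rmin c c') 0 b hb).
    - intros s _. apply continuous_norm2; now apply (loewner_clamp_continuous lambda b z).
    - intros s hs. apply is_derive_norm2; now apply (loewner_clamp_derive lambda b z).
    - intros s hs _.
      assert (I : Icc 0 b s) by (unfold Icc; lra).
      replace (G s - H s)%C with ((G s - RtoC (lambda s)) - (H s - RtoC (lambda s)))%C by ring.
      apply velocity_expansion; [now apply Rmin_pos| |]; unfold G, H; rewrite clamp_id by easy.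
      + apply Rle_trans with (2 := Hc s I), Rmin_l.
      + apply Rle_trans with (2 := Hc' s I), Rmin_r.
    - unfold G, H. rewrite !clamp_id by (unfold Icc; lra).
      rewrite (loewner_init _ _ _ _ Hg), (loewner_init _ _ _ _ Hh).
      unfold norm2, Re, Im, Cminus, Cplus, Copp; simpl. right; ring. }
  unfold G, H in L. rewrite clamp_id in L by (unfold Icc; lra).
  apply (dist_eq (V := CV)). intros e he. rewrite dist_Cmod.
  apply Rle_trans with 0; [|lra]. apply Cmod_le_norm2; [lra|]. simpl. lra.
Qed.

(** * The slit is traced by the reversed flow *)

(** Up to a time [s < t] the reversed flow is taken at times [>= t - s > 0],
    where it is a genuine solution and lies in the upper half-plane. *)
Lemma tip_flow_forward T lambda t s : 0 <= s < t -> t <= T -> half_holder_one T lambda ->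
  let f := tip_flow (reversal T lambda t) in
  loewner_solution lambda s (f t) (fun u => f (t - u)).
Proof.
  intros hst ht Hl f. set (xi := reversal T lambda t) in f.
  assert (HX : global_half_holder xi) by (apply reversal_half_holder; [lra|easy]).
  assert (F := tip_flow_spec xi HX). fold f in F.
  assert (Hxi : forall u, Icc 0 s u -> xi (t - u) = lambda u).
  { intros u hu. apply reversal_at. unfold Icc in *; lra. }
  split.
  - now rewrite Rminus_0_r.
  - intros u hu E. assert (P := flow_upper _ _ _ F (t - u)%R ltac:(unfold Icc in hu; lra)).
    rewrite E in P. simpl in P. lra.
  - intros u hu. apply is_derive_to_within; [easy|].
    assert (D := flow_ode _ _ _ F (t - u) ltac:(unfold Icc in hu; lra)).
    rewrite (Hxi u hu) in D.
    assert (A : is_derive (fun u => t - u) u (-1)) by (auto_derive; [easy|ring]).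
    evar_last; [apply (is_derive_comp (V := C_R_NormedModule) f (fun u => (t - u)%R) u _ _ D A)|].
    unfold velocity. set (w := (/ (f (t - u)%R - RtoC (lambda u)))%C). unfold Cdiv. fold w.
    unfold scal; simpl. unfold prod_scal, scal; simpl. unfold mult; simpl.
    unfold Cmult, RtoC; simpl. f_equal; ring.
Qed.

(** The tip of the slit is the only point that is in the domain at all times
    before [t] but not at time [t]. *)
Lemma slit_eq_tip_flow T lambda gamma t :
  half_holder_one T lambda -> generates_slit T lambda gamma -> 0 < t <= T ->
  gamma t = tip_flow (reversal T lambda t) t.
Proof.
  intros Hl Hg ht.
  assert (Hfwd := fun s (hs : 0 <= s < t) => tip_flow_forward T lambda t s hs (proj2 ht) Hl).
  cbv zeta in Hfwd. set (xi := reversal T lambda t) in *.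
  assert (HX : global_half_holder xi) by (apply reversal_half_holder; [lra|easy]).
  assert (F := tip_flow_spec xi HX). set (f := tip_flow xi) in *.
  assert (U : upper_half_plane (f t)) by (apply (flow_upper _ _ _ F); lra).
  assert (Hin : forall s, 0 <= s < t -> gamma s <> f t).
  { intros s hs E.
    destruct (proj1 (slit_domain _ _ _ Hg s ltac:(unfold Icc; lra) (f t))) as [_ N].
    - split; [easy|]. eexists. now apply Hfwd.
    - apply N. exists s. split; [unfold Icc; lra|easy]. }
  assert (Hout : ~ loewner_domain lambda t (f t)).
  { intros [_ [g Sg]].
    assert (Ht : half_holder_one t lambda).
    { intros a b ha hb. apply Hl; unfold Icc in *; lra. }
    (* By continuity at [t], this agreement gives [g t = f 0 = lambda t]. *)
    assert (Eq : forall s, 0 <= s < t -> g s = f (t - s)).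
    { intros s hs.
      apply (loewner_solution_unique lambda s (f t) g (fun u => f (t - u))); [lra| | |].
      - intros a b ha hb. apply Hl; unfold Icc in *; lra.
      - apply (loewner_solution_restrict lambda s t); [lra|easy].
      - now apply Hfwd. }
    assert (It : Icc 0 t t) by (unfold Icc; lra).
    apply (loewner_avoid _ _ _ _ Sg t It).
    apply (dist_eq (V := CV)). intros e he.
    destruct (is_derive_within_continuous _ _ _ _ It (loewner_ode _ _ _ _ Sg t It) (e/2) ltac:(lra))
      as [d [hd Hd]].
    destruct (proj1 (continuous_dist (V := CV) f 0) (flow_continuous _ _ _ F 0) (e/2) ltac:(lra))
      as [d' [hd' Hd']].
    (* At time [t - r] the point [g (t - r) = f r] is within [e / 2] of both
       [g t] and [lambda t]. *)
    set (r := Rmin t (Rmin d d') / 2).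
    assert (hm : 0 < Rmin t (Rmin d d')) by (repeat apply Rmin_pos; lra).
    pose proof (Rmin_l t (Rmin d d')). pose proof (Rmin_r t (Rmin d d')).
    pose proof (Rmin_l d d'). pose proof (Rmin_r d d').
    assert (hr : 0 < r < t /\ r < d /\ r < d') by (unfold r; lra).
    assert (A := Hd (t - r) ltac:(unfold Icc; lra)
      ltac:(replace (t - r - t) with (- r) by ring; rewrite Rabs_Ropp, Rabs_pos_eq; lra)).
    assert (B := Hd' r ltac:(rewrite Rminus_0_r, Rabs_pos_eq; lra)).
    rewrite (Eq (t - r)) in A by lra. replace (t - (t - r)) with r in A by ring.
    rewrite (flow_start _ _ _ F) in B.
    replace (xi 0) with (lambda t) in B 
      by (rewrite <- (reversal_at T lambda t t) by (unfold Icc; lra); unfold xi; f_equal; ring).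
    rewrite <- dist_Cmod in A.
    pose proof (dist_triangle (V := CV) (g t) (f r) (lambda t, 0)).
    rewrite (dist_sym (V := CV) (f r) (g t)) in A. unfold RtoC. lra. }
  destruct (Classical_Prop.classic (exists s, Icc 0 t s /\ f t = gamma s)) as [[s [hs E]]|N].
  - destruct (Req_dec s t) as [->|hne]; [easy|].
    exfalso. apply (Hin s); [unfold Icc in hs; lra|easy].
  - exfalso. apply Hout. apply (slit_domain _ _ _ Hg); [unfold Icc; lra|]. now split.
Qed.

Lemma slit_comparison T lambda lambda' gamma gamma' eps t :
  half_holder_one T lambda -> half_holder_one T lambda' ->
  generates_slit T lambda gamma -> generates_slit T lambda' gamma' ->
  (forall s, Icc 0 T s -> Rabs (lambda s - lambda' s) <= eps) ->
  Icc 0 T t -> Cmod (gamma t - gamma' t) <= 2 * eps.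
Proof.
  intros Hl Hl' Hg Hg' He ht.
  assert (hT : 0 <= T) by (unfold Icc in ht; lra).
  destruct (Req_dec t 0) as [->|hne].
  - rewrite (slit_start _ _ _ Hg), (slit_start _ _ _ Hg'), <- RtoC_minus, Cmod_R.
    pose proof (He 0 ht). pose proof (Rabs_pos (lambda 0 - lambda' 0)). lra.
  - assert (0 < t <= T) by (unfold Icc in ht; lra).
    rewrite (slit_eq_tip_flow T lambda gamma t), (slit_eq_tip_flow T lambda' gamma' t) by easy.
    apply tip_flow_comparison; [now apply reversal_half_holder|now apply reversal_half_holder|lra|].
    intros r _. apply He. now apply clamp_Icc.
Qed.

Theorem theorem3p3 :
  exists c : R, 0 < c /\
    forall (T : R) (lambda lambda' : R -> R) (gamma gamma' : R -> C),
      0 < T ->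
      half_holder_one T lambda ->
      half_holder_one T lambda' ->
      generates_slit T lambda gamma ->
      generates_slit T lambda' gamma' ->
      Rbar_le
        (sup_on (Icc 0 T) (fun t => Cmod (gamma t - gamma' t)))
        (Rbar_mult (Finite c)
          (sup_on (Icc 0 T) (fun t => Rabs (lambda t - lambda' t)))).
Proof.
  exists 2. split; [lra|]. intros T lambda lambda' gamma gamma' hT Hl Hl' Hg Hg'.
  set (E := sup_on (Icc 0 T) (fun t => Rabs (lambda t - lambda' t))).
  destruct (Lub_Rbar_correct (fun x => exists t, Icc 0 T t /\ x = Rabs (lambda t - lambda' t)))
    as [Eub _].
  fold (sup_on (Icc 0 T) (fun t => Rabs (lambda t - lambda' t))) in Eub. fold E in Eub.
  assert (HE : forall t, Icc 0 T t -> Rbar_le (Rabs (lambda t - lambda' t)) E).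
  { intros t ht. apply Eub. now exists t. }
  clear Eub. clearbody E.
  apply Lub_Rbar_correct. intros x [t [ht ->]].
  destruct E as [eps| |].
  - simpl. now apply (slit_comparison T lambda lambda' gamma gamma' eps t).
  - rewrite (is_Rbar_mult_unique 2 p_infty p_infty); [easy|].
    apply is_Rbar_mult_sym, is_Rbar_mult_p_infty_pos. simpl. lra.
  - exfalso. now apply (HE t ht).
Qed.
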